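(* Let $G$ be an infinite finitely generated nilpotent group. Then $G$ has the cyclic escape property. Consequently, every totally ergodic probability-measure-preserving action of $G$ is directionally expansive.
   Context: All unitary representations are on complex Hilbert spaces. For a unitary representation $(V,\pi)$ of a countable group $G$ and a subgroup $H\leq G$, write $V^H=\{v\in V:\pi(h)v=v\text{ for every }h\in H\}$ and let $P_H$ be the orthogonal projection onto $V^H$. The representation $(V,\pi)$ is totally ergodic if $V^H=\{0\}$ for every finite-index subgroup $H\leq G$. An infinite countable group $G$ has the cyclic escape property if, for every totally ergodic unitary representation $(V,\pi)$ of $G$ and every $v\in V$, $\inf_C\|P_Cv\|=0$, where the infimum is over all infinite cyclic subgroups $C\leq G$. A probability-measure-preserving action $G\curvearrowright(X,\mu)$ of a countable discrete group is totally ergodic if its restriction to every finite-index subgroup of $G$ is ergodic. It is directionally expansive if, for every measurable set $B\subset X$ with $\mu(B)>0$ and every $\varepsilon>0$, there exists a cyclic subgroup $C\leq G$ (finite or infinite) such that $\mu(CB)>1-\varepsilon$, where $CB=\bigcup_{c\in C}cB$. *)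

(* Defs.v *)
From mathcomp Require Import all_boot all_order all_algebra all_fingroup.
From mathcomp Require Import all_classical all_reals all_analysis.
From mathcomp Require Import complex.

Set Implicit Arguments.
Unset Strict Implicit.
Unset Printing Implicit Defensive.

Import Order.TTheory GRing.Theory Num.Theory.
Import numFieldNormedType.Exports.

Local Open Scope classical_set_scope.
Local Open Scope ring_scope.

(* Subsets of a possibly infinite group [G] are classical sets, since
   [{group gT}] is only available for finite groups. *)
Section Groups.
Variable G : groupType.
Implicit Types (A H C : set G).
Local Open Scope group_scope.

Definition is_subgroup H : Prop :=
  [/\ H 1, (forall x y, H x -> H y -> H (x * y)) & (forall x, H x -> H x^-1)].

Definition gen A : set G := smallest is_subgroup A.

Definition is_cyclic C : Prop := exists g, C = gen [set g].

Definition infinite_cyclic C : Prop := is_cyclic C /\ infinite_set C.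

Definition finite_index_subgroup H : Prop :=
  is_subgroup H /\ finite_set (range (fun g : G => [set g * h | h in H])).

Definition finitely_generated : Prop :=
  exists2 A, finite_set A & gen A = [set: G].

Fixpoint lower_central (n : nat) : set G :=
  if n is m.+1 then
    gen [set z | exists x y, lower_central m x /\ z = [~ x, y]]
  else [set: G].

Definition nilpotent_group : Prop := exists n, lower_central n = [set 1].

End Groups.

Arguments finitely_generated : clear implicits.
Arguments nilpotent_group : clear implicits.

(* [R[i]] is the field of complex numbers over [R]. The inner product is linear
   in the first argument and antilinear in the second; [hilbert_normE] says
   that it induces the norm for which the space is complete. *)
Record hilbertSpace (R : realType) := HilbertSpace {
  hilbert_sort :> completeNormedModType R[i] ;
  inner : {dot hilbert_sort for Num.conj} ;
  hilbert_normE : forall v : hilbert_sort, `|v| ^+ 2 = inner v v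
}.

Record unitaryRep (R : realType) (G : groupType) (V : hilbertSpace R) :=
  UnitaryRep {
    rep :> G -> {linear V -> V} ;
    rep1 : forall v, rep 1%g v = v ;
    repM : forall g h v, rep (g * h)%g v = rep g (rep h v) ;
    rep_inner : forall g u v, inner V (rep g u) (rep g v) = inner V u v
  }.

Section UnitaryRep.
Variables (R : realType) (G : groupType) (V : hilbertSpace R).
Implicit Types (pi : unitaryRep G V) (H : set G) (W : set V).

(* The norm of [V] takes its (real, nonnegative) values in [R[i]]. *)
Definition hnorm (v : V) : R := complex.Re `|v|.

Definition is_orth_proj W (v w : V) : Prop :=
  W w /\ forall u, W u -> inner V (v - w) u = 0.

(* When [W] is a closed subspace, there is exactly one [w] such that
   [is_orth_proj W v w]; the default value [v] is then irrelevant. *)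
Definition orth_proj W (v : V) : V := xget v [set w | is_orth_proj W v w].

Definition fixed_vectors pi H : set V :=
  [set v | forall h, H h -> pi h v = v].

Definition totally_ergodic_rep pi : Prop :=
  forall H, finite_index_subgroup H -> fixed_vectors pi H = [set 0].

End UnitaryRep.

(* The infimum is taken in the extended reals, where [ereal_inf set0 = +oo], so
   that the property fails for an infinite group without infinite cyclic
   subgroups. *)
Definition cyclic_escape_property (R : realType) (G : groupType) : Prop :=
  [/\ infinite_set [set: G], countable [set: G] &
    forall (V : hilbertSpace R) (pi : unitaryRep G V),
      totally_ergodic_rep pi ->
      forall v : V,
        ereal_inf [set (hnorm (orth_proj (fixed_vectors pi C) v))%:E
                  | C in @infinite_cyclic G] = 0%E].

Record pmpAction (R : realType) (G : groupType) (d : measure_display)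
    (X : measurableType d) (mu : probability X R) := PmpAction {
  act :> G -> X -> X ;
  act1 : forall x, act 1%g x = x ;
  actM : forall g h x, act (g * h)%g x = act g (act h x) ;
  act_measurable : forall g, measurable_fun [set: X] (act g) ;
  act_preserving : forall g (B : set X),
    measurable B -> mu (act g @^-1` B) = mu B
}.

Section PmpAction.
Variables (R : realType) (G : groupType) (d : measure_display).
Variables (X : measurableType d) (mu : probability X R).
Implicit Types (a : pmpAction G mu) (H C : set G) (B : set X).

Definition ergodic_on a H : Prop :=
  forall B, measurable B -> (forall h, H h -> a h @` B = B) ->
    mu B = 0%E \/ mu B = 1%E.

Definition totally_ergodic_action a : Prop :=
  forall H, finite_index_subgroup H -> ergodic_on a H.

Definition translates a C B : set X := \bigcup_(c in C) (a c @` B).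

Definition directionally_expansive a : Prop :=
  forall B, measurable B -> (0 < mu B)%E ->
  forall eps : R, 0 < eps ->
    exists2 C, is_cyclic C & ((1 - eps)%:E < mu (translates a C B))%E.

End PmpAction.

(* Main.v *)
From HB Require Import structures.
Require Import Defs.
From mathcomp Require Import all_boot all_order all_algebra all_fingroup.
From mathcomp Require Import all_classical all_reals all_analysis.
From mathcomp Require Import measurable_realfun complex zify ring lra.

(** Escape is proved for a group [G] acting by isometries on a real
    semi-Hilbert space [V], that is, a real vector space with a complete positive
    form that may be degenerate. A complex Hilbert space is an instance, for the
    real part of its inner product, and so are the square-integrable functions,
    without identifying functions that agree almost everywhere. One statement,
    [nilpotent_escape], thus serves both unitary representations and
    measure-preserving actions. The projection of [v] onto the vectors fixed by
    [g] enters only through the inner products of [v] with those vectors: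
    [small_along g v e] says that its squared norm is at most [e].

    A finitely generated nilpotent group is built from the trivial subgroup by
    adjoining elements one at a time, each central modulo the preceding subgroup
    ([nilpotent_polycentral]). The proof descends along this chain. For a
    subgroup [L] of the chain, [escapes L] concerns the normal subgroups [N]
    modulo which [L] is finite and the ergodic vectors [v] fixed by [N]: some [g]
    of infinite order modulo [N] makes the projection of [v] arbitrarily small,
    unless [N] has finite index. If [L] is the whole group then [N] has finite
    index, so that [v] is null; if [L] and [N] are both trivial this is the claim.

    To descend from [gen (L `|` [set x])] to [L], let [L] be finite modulo [N].
    A power [z] of [x] is then central modulo [N] ([central_power]), and the
    interesting case is that [z] has infinite order modulo [N]. Let [Nz n] be
    generated by [N] and [z ^+ n]. Write [v = w + u] where [w] is a limit of
    vectors fixed by the groups [Nz n] and [u] is orthogonal to all those vectors.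
    For a suitable [n], the projection of [v] onto the vectors fixed by [Nz n] is
    close to [w], and the larger subgroup of the chain is finite modulo [Nz n]: it
    provides some [g] for this projection, and every [g * z ^+ (n * k)] serves as
    well as [g] since it is congruent to [g] modulo [Nz n]. For [u] the freedom in
    [k] is decisive: among the vectors fixed by [N] and orthogonal to all vectors
    fixed by the [Nz n], those fixed by [g * z ^+ (n * k)] and those fixed by
    [g * z ^+ (n * l)] are orthogonal, because these two elements commute modulo
    [N] and a common fixed vector would be fixed by a power of [z]. By Bessel's
    inequality, [u] has a small projection for some [k]. This is [central_step].

    For a totally ergodic action, take [v] to be the centered indicator of [B] in
    the Koopman representation. It is ergodic, because the functions fixed by a
    finite-index subgroup are constant ([ergodic_fixed_const]). If [D] is the union of
    the translates of [B] by the powers of [g], testing smallness against the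
    centered indicator of [D], which [g] fixes, bounds [mu B ^+ 2 * (1 - mu D)]. *)

Set Implicit Arguments.
Unset Strict Implicit.
Unset Printing Implicit Defensive.

Import Order.TTheory GRing.Theory Num.Theory.
Import numFieldNormedType.Exports.

Local Open Scope classical_set_scope.
Local Open Scope ring_scope.

(** * Subgroups *)

Section Subgroups.
Variable G : groupType.
Implicit Types (x y g : G) (A H L N : set G).
Local Open Scope group_scope.

Lemma subgX H x n : is_subgroup H -> H x -> H (x ^+ n).
Proof.
move=> [H1 HM _] Hx; elim: n => [|n IH]; first by rewrite expg0.
by rewrite expgS; exact: HM.
Qed.

Lemma gen_subgroup A : is_subgroup (gen A).
Proof.
split=> [B [[B1 _ _] _] //|x y gx gy B hB|x gx B hB].
  by have [[_ BM _] _] := hB; apply: BM; [exact: gx|exact: gy].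
by have [[_ _ BV] _] := hB; apply: BV; exact: gx.
Qed.

Lemma sub_gen A : A `<=` gen A.
Proof. exact: sub_gen_smallest. Qed.

Lemma gen_sub A H : is_subgroup H -> A `<=` H -> gen A `<=` H.
Proof. by move=> sH AH; exact: smallest_sub. Qed.

Lemma gen_id H : is_subgroup H -> gen H = H.
Proof.
by move=> sH; apply/seteqP; split; [exact: gen_sub|exact: sub_gen].
Qed.

Lemma is_subgroup1 : is_subgroup [set (1 : G)].
Proof.
split=> //= [x y -> ->|x ->]; first by rewrite mulg1.
by rewrite invg1.
Qed.

Definition normal_subgroup N := is_subgroup N /\ forall x g, N x -> N (x ^ g).

Lemma normal_gen A : (forall x g, A x -> gen A (x ^ g)) ->
  normal_subgroup (gen A).
Proof.
move=> AJ; split=> [|x g gx]; first exact: gen_subgroup.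
have [g1 gM gV] := gen_subgroup A.
suff : gen A `<=` [set y | gen A (y ^ g)] by apply.
apply: gen_sub; last by move=> y Ay; exact: AJ.
split=> /= [|y z gy gz|y gy]; rewrite ?conj1g ?conjMg ?conjVg //.
  exact: gM.
exact: gV.
Qed.

(** Every element is the value of a word in the generators and their inverses,
    and such words are coded by a countable type. *)
Lemma finitely_generated_countable :
  finitely_generated G -> countable [set: G].
Proof.
move=> [A /finite_seqP[a ->] <-].
pose letter (p : nat * bool) :=
  if p.2 then nth 1 a p.1 else (nth 1 a p.1)^-1.
pose word (w : seq (nat * bool)) := foldr (fun p x => letter p * x) 1 w.
have wcat w1 w2 : word (w1 ++ w2) = word w1 * word w2.
  by elim: w1 => [|p w1 IH] /=; rewrite ?mul1g // IH mulgA.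
apply: (@sub_countable _ _ _ (range word)); last first.
  exact: (sub_countable (card_image_le _ _)).
apply: subset_card_le; apply: gen_sub.
  split.
  - by exists [::].
  - by move=> _ _ [w1 _ <-] [w2 _ <-]; exists (w1 ++ w2).
  - move=> _ [w _ <-].
    exists (rev [seq (p.1, ~~ p.2) | p <- w]) => //.
    elim: w => [|p w IH] /=; first by rewrite invg1.
    rewrite rev_cons -cats1 wcat IH invgM /= mulg1; congr (_ * _).
    by rewrite /letter /=; case: (p.2) => //=; rewrite invgK.
move=> x xa; exists [:: (index x a, true)] => //=.
by rewrite /letter /= mulg1 nth_index.
Qed.

(** * Congruence modulo a normal subgroup *)

Definition eqmod N x y := N (x^-1 * y).

Section Congruence.
Variables (N : set G) (nN : normal_subgroup N).
Let N1 : N 1. Proof. by case: nN => -[]. Qed.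
Let NM x y : N x -> N y -> N (x * y). Proof. by case: nN => -[_ + _] _; apply. Qed.
Let NV x : N x -> N x^-1. Proof. by case: nN => -[_ _ +] _; apply. Qed.
Let NJ x g : N x -> N (x ^ g). Proof. by case: nN => _; apply. Qed.

Lemma eqmod_refl x : eqmod N x x.
Proof. by rewrite /eqmod mulVg. Qed.

Lemma eqmod_sym x y : eqmod N x y -> eqmod N y x.
Proof. by move=> /NV; rewrite /eqmod invgM invgK. Qed.

Lemma eqmod_trans x y z : eqmod N x y -> eqmod N y z -> eqmod N x z.
Proof. by move=> xy /(NM xy); rewrite /eqmod mulgA mulgK. Qed.

Lemma eqmodM x x' y y' :
  eqmod N x x' -> eqmod N y y' -> eqmod N (x * y) (x' * y').
Proof.
move=> /(@NJ _ y) xx' /(NM xx').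
by rewrite /eqmod conjgE invgM !mulgA mulgK.
Qed.

Lemma eqmodX x y n : eqmod N x y -> eqmod N (x ^+ n) (y ^+ n).
Proof.
move=> xy; elim: n => [|n IH]; first by rewrite !expg0; exact: eqmod_refl.
by rewrite !expgS; exact: eqmodM.
Qed.

Lemma eqmod_mem x y : eqmod N x y -> N x -> N y.
Proof. by move=> xy Nx; have := NM Nx xy; rewrite mulVKg. Qed.

Lemma eqmod_commg x g : N [~ x, g] <-> eqmod N (g * x) (x * g).
Proof. by rewrite /eqmod commgEl conjgE invgM !mulgA. Qed.

Lemma commg_subgroup g : is_subgroup [set x | N [~ x, g]].
Proof.
split=> /= [|x y /eqmod_commg xg /eqmod_commg yg|x /eqmod_commg xg].
- by rewrite comm1g.
- apply/eqmod_commg; rewrite mulgA.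
  apply: (@eqmod_trans _ (x * g * y)).
    by apply: eqmodM => //; exact: eqmod_refl.
  by rewrite -!mulgA; apply: eqmodM => //; exact: eqmod_refl.
- apply/eqmod_commg.
  have := eqmodM (eqmodM (eqmod_refl x^-1) xg) (eqmod_refl x^-1).
  by rewrite !mulgA mulgK mulVg mul1g => /eqmod_sym.
Qed.

Lemma commgr_subgroup x : is_subgroup [set g | N [~ x, g]].
Proof.
have [h1 hM hV] := commg_subgroup x.
have sw y z : N [~ y, z] -> N [~ z, y] by move=> /NV; rewrite invgR.
split=> /= [|g h xg xh|g xg]; apply: (sw).
- exact: h1.
- by apply: hM; exact: sw.
- by apply: hV; exact: sw.
Qed.

End Congruence.

(** * Finitely generated nilpotent groups are polycentral *)

(** Adjoining a single element at each step, instead of a whole quotient of the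
    lower central series, leaves only one new element [x] to be dealt with in
    [escapes_adjoin]. *)
Inductive polycentral : set G -> Prop :=
| polycentral1 : polycentral [set 1]
| polycentral_adjoin L x : polycentral L -> (forall g, L [~ x, g]) ->
    polycentral (gen (L `|` [set x])).

Lemma normal_adjoin L x : normal_subgroup L -> (forall g, L [~ x, g]) ->
  normal_subgroup (gen (L `|` [set x])).
Proof.
move=> [_ LJ] Lx; apply: normal_gen => y g [Ly|->].
  by apply: sub_gen; left; exact: LJ.
have [_ gM _] := gen_subgroup (L `|` [set x]).
rewrite (_ : x ^ g = x * [~ x, g]); last by rewrite commgEl mulVKg.
by apply: gM; apply: sub_gen; [right|left].
Qed.

Lemma polycentral_normal L : polycentral L -> normal_subgroup L.
Proof.
elim=> [|{}L x _ nL Lx]; last exact: normal_adjoin.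
by split=> [|x g ->]; [exact: is_subgroup1|rewrite /= conj1g].
Qed.

Lemma polycentral_adjoin_seq L (s : seq G) : polycentral L ->
  (forall x g, x \in s -> L [~ x, g]) -> polycentral (gen (L `|` [set` s])).
Proof.
move=> pL; elim: s => [|x s IH] Ls.
  rewrite set_nil setU0 gen_id //.
  by case: (polycentral_normal pL).
have {}IH : polycentral (gen (L `|` [set` s])).
  by apply: IH => y g ys; apply: Ls; rewrite inE ys orbT.
suff -> : gen (L `|` [set` x :: s]) =
    gen (gen (L `|` [set` s]) `|` [set x]).
  apply: polycentral_adjoin => // g; apply: sub_gen; left.
  by apply: Ls; rewrite inE eqxx.
apply/seteqP; split; apply: gen_sub; try exact: gen_subgroup.
- move=> y [Ly|/=]; first by apply: sub_gen; left; apply: sub_gen; left.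
  rewrite inE => /predU1P[->|ys]; first by apply: sub_gen; right.
  by apply: sub_gen; left; apply: sub_gen; right.
- move=> y [|->]; last by apply: sub_gen; right; rewrite /= inE eqxx.
  apply: gen_sub; first exact: gen_subgroup.
  move=> z [Lz|zs]; apply: sub_gen; [by left|right].
  by rewrite /= inE (zs : z \in s) orbT.
Qed.

Lemma lower_central_normal n : normal_subgroup (lower_central (G := G) n).
Proof.
elim: n => [|n [_ IH]]; first by split=> //; split.
apply: normal_gen => _ g [x [y [Lx ->]]]; apply: sub_gen.
by exists (x ^ g), (y ^ g); rewrite conjRg; split=> //; exact: IH.
Qed.

Lemma lower_centralS n :
  lower_central (G := G) n.+1 `<=` lower_central (G := G) n.
Proof.
have [[_ LM LV] LJ] := lower_central_normal n.
apply: gen_sub; first by case: (lower_central_normal n).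
move=> _ [x [y [Lx ->]]]; rewrite commgEl.
by apply: LM; [exact: LV|exact: LJ].
Qed.

Lemma lower_central_comm n x y :
  lower_central (G := G) n x -> lower_central (G := G) n.+1 [~ x, y].
Proof. by move=> Lx; apply: sub_gen; exists x, y. Qed.

(** Modulo the term after next, commutators are bilinear, so that commutators of
    generators generate. Bilinearity appears as the statement that, for the normal
    subgroup [T], the elements [x] with [~ x, z] in [T] form a subgroup, and likewise
    in the other variable. *)
Lemma lower_central_fg n : finitely_generated G ->
  exists s : seq G, [set` s] `<=` lower_central (G := G) n /\
    lower_central (G := G) n = gen (lower_central (G := G) n.+1 `|` [set` s]).
Proof.
move=> [A /finite_seqP[a Aa] genA]; rewrite {A}Aa in genA.
elim: n => [|n [s [sL genL]]].
  exists a; split=> //; apply/seteqP; split=> // x _.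
  have : gen [set` a] x by rewrite genA.
  apply: gen_sub; first exact: gen_subgroup.
  by move=> y ya; apply: sub_gen; right.
pose t := [seq [~ x, y] | x <- s, y <- a].
have tL : [set` t] `<=` lower_central (G := G) n.+1.
  move=> _ /allpairsP[[x y] /= [xs _ ->]].
  by apply: lower_central_comm; exact: sL.
exists t; split=> //.
pose T := gen (lower_central (G := G) n.+2 `|` [set` t]).
have TL : T `<=` lower_central (G := G) n.+1.
  apply: gen_sub; first by case: (lower_central_normal n.+1).
  by move=> x [/lower_centralS|/tL].
have nT : normal_subgroup T.
  apply: normal_gen => x g Lx.
  have [_ gM _] := gen_subgroup (lower_central (G := G) n.+2 `|` [set` t]).
  rewrite (_ : x ^ g = x * [~ x, g]); last by rewrite commgEl mulVKg.
  apply: gM; first exact: sub_gen.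
  apply: sub_gen; left; apply: lower_central_comm; apply: TL; exact: sub_gen.
apply/seteqP; split=> //.
apply: gen_sub; first by case: nT.
move=> _ [x [y [Lx ->]]].
suff xT z : z \in a -> T [~ x, z].
  have : gen [set` a] y by rewrite genA.
  by apply: (gen_sub (commgr_subgroup nT x)) => z; exact: xT.
move=> za; have : lower_central (G := G) n x by [].
rewrite genL.
apply: (gen_sub (commg_subgroup nT z)) => w [Lw|ws]; apply: sub_gen.
  by left; exact: lower_central_comm.
by right; apply/allpairsP; exists (w, z).
Qed.

(** The generators of each term of the lower central series modulo the next one
    are central modulo that next one, hence can be adjoined one by one. *)
Theorem nilpotent_polycentral :
  finitely_generated G -> nilpotent_group G -> polycentral [set: G].
Proof.
move=> fG [n Ln]; suff : forall k, polycentral (lower_central (n - k)).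
  by move=> /(_ n); rewrite subnn.
elim=> [|k IH]; first by rewrite subn0 Ln; exact: polycentral1.
have [kn|nk] := ltnP k n; last first.
  by have -> : (n - k.+1 = n - k)%N by lia.
move: IH; rewrite (_ : n - k = (n - k.+1).+1)%N; last by rewrite subnSK.
have [s [sL ->]] := lower_central_fg (n - k.+1) fG.
move=> pL; apply: polycentral_adjoin_seq => // x g xs.
by apply: lower_central_comm; exact: sL.
Qed.

End Subgroups.

(** * Finiteness modulo a normal subgroup *)

Section FiniteModulo.
Variable G : groupType.
Implicit Types (x y g : G) (A H L M N : set G).
Local Open Scope group_scope.

Definition finite_mod L N :=
  exists s : seq G, forall y, L y -> exists2 t, t \in s & eqmod N t y.

Lemma finite_modS L M N : M `<=` N -> finite_mod L M -> finite_mod L N.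
Proof.
move=> MN [s Ls]; exists s => y /Ls[t ts ty]; exists t => //; exact: MN.
Qed.

Lemma finite_mod_index N : normal_subgroup N -> finite_mod [set: G] N ->
  finite_index_subgroup N.
Proof.
move=> nN [s Gs]; have [sN _] := nN; split=> //.
apply: (@sub_finite_set _ _
  ((fun t => [set t * h | h in N]) @` [set` s])); last first.
  by apply: finite_image; exact: finite_seq.
move=> _ [g _ <-]; have [t ts tg] := Gs g I; exists t => //.
apply/seteqP; split=> _ [h Nh <-].
  exists (g^-1 * (t * h)); last by rewrite mulVKg.
  have [_ NM _] := sN; rewrite mulgA; apply: NM => //.
  exact: eqmod_sym tg.
exists (t^-1 * (g * h)); last by rewrite mulVKg.
by have [_ NM _] := sN; rewrite mulgA; apply: NM.
Qed.

(** Products [x ^+ i * h * m] with [i] natural form a subgroup because [x]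
    normalizes [L] and has the inverse [x ^+ K.-1] modulo [M]; then [i] only
    matters modulo [K]. *)
Lemma finite_mod_adjoin L M x K : normal_subgroup L -> normal_subgroup M ->
  finite_mod L M -> (0 < K)%N -> M (x ^+ K) ->
  finite_mod (gen (L `|` [set x])) M.
Proof.
move=> [[L1 LM LV] LJ] nM [s Ls] K0 MxK.
have [[M1 MM MV] MJ] := nM.
pose T : set G := [set y | exists i h, L h /\ eqmod M (x ^+ i * h) y].
have TM y z : T y -> T z -> T (y * z).
  move=> [i [h [Lh hy]]] [j [k [Lk kz]]].
  exists (i + j)%N, (h ^ (x ^+ j) * k); split; first by apply: LM => //; exact: LJ.
  have := eqmodM nM hy kz.
  by rewrite conjgE expgnDr !mulgA mulgK.
have TL : L `<=` T.
  by move=> h Lh; exists 0%N, h; rewrite expg0 mul1g; split=> //; exact: eqmod_refl.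
have TMsub : M `<=` T.
  move=> m Mm; exists 0%N, 1; rewrite expg0 mul1g; split=> //.
  by rewrite /eqmod invg1 mul1g.
have Tx i : T (x ^+ i).
  by exists i, 1; split=> //; rewrite mulg1; exact: eqmod_refl.
have TV y : T y -> T y^-1.
  move=> [i [h [Lh hy]]].
  have -> : y^-1 = ((x ^+ i * h)^-1 * y)^-1 * h^-1 * (x ^+ i)^-1.
    by rewrite !invgM !invgK !mulgA mulgK mulgK.
  apply: (TM).
    by apply: (TM); [apply: TMsub; exact: MV|apply: TL; exact: LV].
  have -> : (x ^+ i)^-1 = x ^+ (i * K - i) * (x ^+ (K * i))^-1.
    rewrite mulnC expgnFr; last by rewrite leq_pmull.
    by rewrite -mulgA -invgM -expgnDr addnC expgnDr invgM mulgA mulgV mul1g.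
  apply: (TM) => //; apply: TMsub; apply: MV; rewrite expgnA.
  by apply: subgX; first by case: nM.
have genT : gen (L `|` [set x]) `<=` T.
  apply: gen_sub; first by split=> //; apply: TL.
  by move=> y [/TL|->] //; have := Tx 1%N; rewrite expg1.
exists [seq x ^+ i * t | i <- iota 0 K, t <- s] => y /genT[i [h [Lh hy]]].
have [t ts th] := Ls h Lh.
exists (x ^+ (i %% K) * t).
  by apply: allpairs_f => //; rewrite mem_iota /= add0n ltn_mod.
apply: eqmod_trans hy => //; apply: eqmodM => //.
rewrite {2}(divn_eq i K) mulnC /eqmod addnC expgnDr mulKg expgnA.
by apply: subgX; first by case: nM.
Qed.

(** Among the commutators of [g] with the first powers of [x], two agree
    modulo [N]; the corresponding quotient of powers commutes with [g], with an
    exponent bounded independently of [g]. *)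
Lemma central_power L N x : normal_subgroup L -> normal_subgroup N ->
  (forall g, L [~ x, g]) -> finite_mod L N ->
  exists2 K, (0 < K)%N & forall g, N [~ x ^+ K, g].
Proof.
move=> nL nN Lx [s Ls]; exists (size s)`!; first exact: fact_gt0.
move=> g.
(* [f k] is the position in [s] of the class of [~ x ^+ k, g] modulo [N]. *)
have Lk k : L [~ x ^+ k, g] by exact: (subgX k (commg_subgroup nL g)).
pose P k i := (i < size s)%N /\ eqmod N (nth 1 s i) [~ x ^+ k, g].
have /choice[f fP] : forall k, exists i, P k i.
  move=> k; have [t ts tN] := Ls _ (Lk k).
  by exists (index t s); rewrite /P index_mem nth_index.
have [k [l [kl ls fkl]]] : exists k l, [/\ (k < l)%N, (l <= size s)%N & f k = f l].
  pose F (k : 'I_(size s).+1) : 'I_(size s) := Ordinal (fP k).1.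
  have : ~~ injectiveb F.
    by apply/injectiveP => /leq_card; rewrite !card_ord ltnn.
  move=> /injectivePn[i [j ij /(congr1 val) /= fij]].
  have /orP[lt|lt] : (i < j)%N || (j < i)%N by rewrite -neq_ltn.
    by exists i, j; split=> //; rewrite -ltnS ltn_ord.
  by exists j, i; split=> //; rewrite -ltnS ltn_ord.
have [sN NJ] := nN.
have kl_eq : eqmod N [~ x ^+ k, g] [~ x ^+ l, g].
  apply: (eqmod_trans nN (y := nth 1 s (f k))).
    by apply: (eqmod_sym nN); exact: (fP k).2.
  by rewrite fkl; exact: (fP l).2.
have xlk : N [~ x ^+ (l - k), g].
  rewrite commgEr.
  set u := x ^+ (l - k).
  have lE : x ^+ l = u * x ^+ k by rewrite -expgnDr subnK // ltnW.
  move: kl_eq; rewrite !commgEr => kg.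
  have {}kg : eqmod N (g^-1 ^ x ^+ k) (g^-1 ^ x ^+ l).
    by have := eqmodM nN kg (eqmod_refl nN g^-1); rewrite !mulgK.
  move: kg; rewrite lE conjgM /eqmod -conjVg -conjMg => /(NJ _ (x ^+ k)^-1).
  rewrite conjgK invgK => gu.
  have /(NJ _ g) : N (g * (g^-1 ^ u)) by [].
  by rewrite [_ ^ g]conjgE -mulgA mulKg.
have /dvdnP[q ->] : (l - k %| (size s)`!)%N.
  by apply: dvdn_fact; rewrite subn_gt0 kl (leq_trans (leq_subr _ _)).
rewrite mulnC expgnA.
exact: (subgX q (commg_subgroup nN g)).
Qed.

End FiniteModulo.

(** * Real semi-Hilbert spaces *)

(** The form may be degenerate, which spares the passage to almost-everywhere
    classes for spaces of functions. Completeness is only required for sequences that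
    converge geometrically: those are the ones for which a limit of functions
    exists almost everywhere, and minimizing sequences can be chosen so. The bound
    on [4^-1 ^+ i] in the conclusion forces the index of the approximation to
    be large. *)
Record semiHilbert (R : realType) := SemiHilbert {
  semiHilbert_sort :> lmodType R;
  ip : semiHilbert_sort -> semiHilbert_sort -> R;
  ipC : forall x y, ip x y = ip y x;
  ip_linear : forall a x y z, ip (a *: x + y) z = a * ip x z + ip y z;
  ip_ge0 : forall x, 0 <= ip x x;
  ip_complete : forall s : nat -> semiHilbert_sort,
    (forall i j, (i <= j)%N -> ip (s i - s j) (s i - s j) <= 4^-1 ^+ i) ->
    exists w, forall e, 0 < e ->
      exists i, ip (w - s i) (w - s i) <= e /\ 4^-1 ^+ i <= e
}.

Section SemiHilbertGeometry.
Variables (R : realType) (V : semiHilbert R).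
Implicit Types (x y z v w : V) (S W : set V) (a b c d e t : R).

Local Notation "'[ x , y ]" := (ip x y).
Local Notation "'[ x ]" := (ip x x).

Lemma ip0l z : '[0, z] = 0.
Proof.
have := ip_linear 1 0 0 z; rewrite scale1r addr0 mul1r => /eqP.
by rewrite -subr_eq0 opprD addrA subrr sub0r oppr_eq0 => /eqP.
Qed.

Lemma ipDl x y z : '[x + y, z] = '[x, z] + '[y, z].
Proof. by have := ip_linear 1 x y z; rewrite scale1r mul1r. Qed.

Lemma ipZl a x z : '[a *: x, z] = a * '[x, z].
Proof. by have := ip_linear a x 0 z; rewrite addr0 ip0l addr0. Qed.

Lemma ipNl x z : '[- x, z] = - '[x, z].
Proof. by rewrite -scaleN1r ipZl mulN1r. Qed.

Lemma ipBl x y z : '[x - y, z] = '[x, z] - '[y, z].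
Proof. by rewrite ipDl ipNl. Qed.

Lemma ip0r z : '[z, 0] = 0. Proof. by rewrite ipC ip0l. Qed.

Lemma ipDr x y z : '[z, x + y] = '[z, x] + '[z, y].
Proof. by rewrite ipC ipDl !(ipC z). Qed.

Lemma ipZr a x z : '[z, a *: x] = a * '[z, x].
Proof. by rewrite ipC ipZl !(ipC z). Qed.

Lemma ipNr x z : '[z, - x] = - '[z, x].
Proof. by rewrite ipC ipNl !(ipC z). Qed.

Lemma ipBr x y z : '[z, x - y] = '[z, x] - '[z, y].
Proof. by rewrite ipDr ipNr. Qed.

Definition ipE := (ipDl, ipDr, ipNl, ipNr, ipZl, ipZr).

Lemma discriminant_le a b c : 0 <= a ->
  (forall t, 0 <= c - 2 * t * b + t ^+ 2 * a) -> b ^+ 2 <= c * a.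
Proof.
rewrite le_eqVlt => /predU1P[<-|a0] h.
  rewrite mulr0; have [->|b0] := eqVneq b 0; first by rewrite expr0n.
  have := h ((c + 1) / (2 * b)).
  have -> : c - 2 * ((c + 1) / (2 * b)) * b + ((c + 1) / (2 * b)) ^+ 2 * 0 = -1.
    by field.
  by rewrite oppr_ge0 ler10.
have := mulr_ge0 (h (b / a)) (ltW a0).
have -> : (c - 2 * (b / a) * b + (b / a) ^+ 2 * a) * a = c * a - b ^+ 2.
  by field; rewrite gt_eqF.
by rewrite subr_ge0.
Qed.

Lemma cauchy_schwarz x y : '[x, y] ^+ 2 <= '[x] * '[y].
Proof.
apply: discriminant_le => [|t]; first exact: ip_ge0.
have -> : '[x] - 2 * t * '[x, y] + t ^+ 2 * '[y] = '[x - t *: y].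
  by rewrite !ipE (ipC y x); ring.
exact: ip_ge0.
Qed.

Lemma ip_null x y : '[x] = 0 -> '[x, y] = 0.
Proof.
move=> x0; have := cauchy_schwarz x y; rewrite x0 mul0r => h.
by apply/eqP; rewrite -sqrf_eq0 eq_le h sqr_ge0.
Qed.

Lemma sqr_small a : (forall e, 0 < e -> a ^+ 2 <= e) -> a = 0.
Proof.
move=> h; apply/eqP; rewrite -sqrf_eq0 eq_le sqr_ge0 andbT.
by apply/ler_addgt0Pl => e /h; rewrite addr0.
Qed.

(** The orthogonal complement of a vector is closed. *)
Lemma ip_approx w x :
  (forall e, 0 < e -> exists y, '[w - y] <= e /\ '[y, x] = 0) ->
  '[w, x] = 0.
Proof.
move=> h; apply: sqr_small => e e0.
have x1 : 0 < '[x] + 1 by rewrite ltr_wpDl // ip_ge0.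
have [y [wy yx]] := h (e / ('[x] + 1)) (divr_gt0 e0 x1).
have -> : '[w, x] = '[w - y, x] by rewrite ipBl yx subr0.
apply: (le_trans (cauchy_schwarz _ _)).
apply: (le_trans (ler_wpM2r (ip_ge0 x) wy)).
rewrite -mulrA ler_piMr ?(ltW e0) // mulrC ler_pdivrMr // mul1r.
by rewrite lerDl.
Qed.

(** * Orthogonal projections *)

Definition subspace W :=
  [/\ W 0, (forall x y, W x -> W y -> W (x + y)) &
    forall a x, W x -> W (a *: x)].

Lemma pow4_small e : 0 < e -> exists i, 4^-1 ^+ i <= e :> R.
Proof.
move=> e0.
suff h i : 4^-1 ^+ i <= i.+1%:R^-1 :> R.
  exists (Num.truncn e^-1); apply: le_trans (h _) _.
  rewrite invf_ple ?posrE //.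
  by apply: ltW; exact: Num.Theory.truncnS_gt.
rewrite exprVn lef_pV2 ?posrE ?exprn_gt0 //.
elim: i => [|i IH]; first by rewrite expr0.
rewrite exprS -natr1; have : 1 <= i.+1%:R :> R by rewrite ler1n.
by move: IH; lra.
Qed.

(** The parallelogram identity makes a minimizing sequence for the distance from
    [v] to [W] converge geometrically. The subspace need not be closed, which
    allows an increasing union of closed subspaces for [W]. *)
Lemma projection_closure W v : subspace W ->
  exists2 w, (forall e, 0 < e -> exists2 y, W y & '[w - y] <= e) &
    forall x, W x -> '[v - w, x] = 0.
Proof.
move=> [W0 WD WZ].
pose D := [set '[v - y] | y in W].
have infD : has_inf D.
  split; first by exists '[v - 0]; exists 0.
  by exists 0 => _ [y _ <-]; exact: ip_ge0.
pose d := inf D.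
have dP y : W y -> d <= '[v - y].
  by move=> Wy; apply: ge_inf; [case: infD|exists y].
have /choice[s sP] : forall i, exists y, W y /\ '[v - y] <= d + 4^-1 ^+ i / 4.
  move=> i; have e0 : 0 < 4^-1 ^+ i / 4 :> R by rewrite divr_gt0 ?exprn_gt0.
  have [_ [y Wy <-] yd] := inf_adherent e0 infD.
  by exists y; split=> //; exact: ltW.
have scauchy i j : (i <= j)%N -> '[s i - s j] <= 4^-1 ^+ i.
  move=> ij; have [Wi hi] := sP i; have [Wj hj] := sP j.
  have Wm : W (2^-1 *: (s i + s j)) by apply: WZ; exact: WD.
  have := dP _ Wm.
  have ji : 4^-1 ^+ j <= 4^-1 ^+ i :> R by apply: ler_wiXn2l => //; lra.
  move: hi hj; rewrite !ipE !(ipC (s i) v) !(ipC (s j) v) !(ipC (s j) (s i)).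
  by lra.
have [w sw] := ip_complete scauchy.
exists w => [e /sw[i [wi _]]|x Wx]; first by exists (s i) => //; case: (sP i).
apply: sqr_small => e e0.
have x1 : 0 < 4 * ('[x] + 1) by have := ip_ge0 x; lra.
have [i [wi small_i]] := sw (e / (4 * ('[x] + 1))) (divr_gt0 e0 x1).
have [Wi hi] := sP i.
(* Moving the near-minimizer [s i] along [x] cannot reduce the distance. *)
have h1 : '[v - s i, x] ^+ 2 <= (4^-1 ^+ i / 4) * '[x].
  apply: discriminant_le => [|t]; first exact: ip_ge0.
  have := dP (s i + t *: x) (WD _ _ Wi (WZ t _ Wx)).
  move: hi; rewrite !ipE (ipC (s i) v) !(ipC x).
  by lra.
have h2 : '[w - s i, x] ^+ 2 <= (e / (4 * ('[x] + 1))) * '[x].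
  apply: (le_trans (cauchy_schwarz _ _)).
  by apply: ler_wpM2r => //; exact: ip_ge0.
have h3 : (4^-1 ^+ i / 4) * '[x] <= (e / (4 * ('[x] + 1))) * '[x].
  apply: ler_wpM2r; first exact: ip_ge0.
  have : 0 <= 4^-1 ^+ i :> R by rewrite exprn_ge0.
  by move: small_i; lra.
have h4 : (e / (4 * ('[x] + 1))) * '[x] <= e / 4.
  rewrite invfM mulrA -mulrA ler_piMr ?divr_ge0 ?(ltW e0) //.
  rewrite mulrC ler_pdivrMr; last by have := ip_ge0 x; lra.
  by lra.
have -> : '[v - w, x] = '[v - s i, x] - '[w - s i, x].
  by rewrite !ipE; ring.
nra.
Qed.

Definition orthogonal_to S : set V := [set x | forall y, S y -> '[x, y] = 0].

Lemma orthogonal_toU S T :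
  orthogonal_to (S `|` T) = orthogonal_to S `&` orthogonal_to T.
Proof.
apply/seteqP; split=> [x xST|x [xS xT] y [/xS|/xT] //].
by split=> y ?; apply: xST; [left|right].
Qed.

Lemma orthogonal_to_subspace S : subspace (orthogonal_to S).
Proof.
split=> [y _|x y xS yS z Sz|a x xS z Sz]; first by rewrite ip0l.
  by rewrite ipDl xS // yS // addr0.
by rewrite ipZl xS // mulr0.
Qed.

(** Closed subspaces are presented as orthogonal complements: this is the form
    in which fixed vectors arise, and intersections are immediate. *)
Definition closed_subspace W := exists S, W = orthogonal_to S.

Lemma closed_subspaceI W X :
  closed_subspace W -> closed_subspace X -> closed_subspace (W `&` X).
Proof. by move=> [S ->] [T ->]; exists (S `|` T); rewrite orthogonal_toU. Qed.

Lemma closed_subspace_linear W : closed_subspace W -> subspace W.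
Proof. by move=> [S ->]; exact: orthogonal_to_subspace. Qed.

Lemma projection W v : closed_subspace W ->
  exists2 p, W p & forall x, W x -> '[v - p, x] = 0.
Proof.
move=> [S ->]; have [p pS vp] := projection_closure v (orthogonal_to_subspace S).
exists p => // y Sy; apply: ip_approx => e /pS[z zS pz].
by exists z; split=> //; exact: zS.
Qed.

Lemma projection_le W v p : W p -> (forall x, W x -> '[v - p, x] = 0) ->
  '[p] <= '[v].
Proof.
move=> Wp /(_ p Wp); rewrite !ipE => vp.
have := ip_ge0 (v - p); rewrite !ipE (ipC p v); lra.
Qed.

(** Bessel's inequality leaves no room for infinitely many orthogonal
    components that are bounded below. *)
Lemma bessel (p : nat -> V) u e : 0 < e ->
  (forall k l, (k < l)%N -> '[p k, p l] = 0) ->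
  (forall k, '[u - p k, p k] = 0) -> exists k, '[p k] <= e.
Proof.
move=> e0 orth up; apply: contrapT => /forallNP big.
have {}big k : e <= '[p k].
  by apply: ltW; rewrite ltNge; apply/negP; exact: big.
have upk k : '[u, p k] = '[p k] by have := up k; rewrite !ipE; lra.
have bound K : exists s, [/\ '[u, s] = '[s], K%:R * e <= '[s] &
    forall l, (K <= l)%N -> '[s, p l] = 0].
  elim: K => [|K [s [us Ks sl]]].
    by exists 0; split=> [||l _]; rewrite ?ip0r ?ip0l ?mul0r.
  exists (s + p K); split.
  - by rewrite !ipE us upk (ipC (p K)) sl // addr0 add0r.
  - rewrite !ipE (ipC (p K)) sl // addr0 add0r -natr1 mulrDl mul1r.
    by apply: lerD.
  - by move=> l Kl; rewrite ipDl sl ?orth ?addr0 // ltnW.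
have [s [us Ks _]] := bound (Num.truncn ('[u] / e)).+1.
have : '[s] <= '[u] by have := ip_ge0 (u - s); rewrite !ipE (ipC s u); lra.
apply/negP; rewrite -ltNge; apply: lt_le_trans Ks.
by rewrite -ltr_pdivrMr //; exact: Num.Theory.truncnS_gt.
Qed.

End SemiHilbertGeometry.

(** * Escape for isometric representations *)

Local Notation "'[ x , y ]" := (ip x y).
Local Notation "'[ x ]" := (ip x x).

Record orthogonalRep (R : realType) (G : groupType) (V : semiHilbert R) :=
  OrthogonalRep {
    orep :> G -> V -> V;
    orep1 : forall v, orep 1%g v = v;
    orepM : forall g h v, orep (g * h)%g v = orep g (orep h v);
    orep_linear : forall g a v w, orep g (a *: v + w) = a *: orep g v + orep g w;
    orep_ip : forall g v w, '[orep g v, orep g w] = '[v, w]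
  }.

Section Escape.
Variables (R : realType) (G : groupType) (V : semiHilbert R).
Variable pi : orthogonalRep G V.
Implicit Types (g h z : G) (A H L N : set G) (x y u v w p : V) (W : set V).

Lemma orepVK g x : pi g (pi g^-1%g x) = x.
Proof. by rewrite -orepM mulgV orep1. Qed.

Lemma ip_orepl g x y : '[pi g x, y] = '[x, pi g^-1%g y].
Proof. by rewrite -{1}(orepVK g y) orep_ip. Qed.

(** Invariance is tested against all vectors, since the form may be degenerate;
    in this form the vectors fixed by a set are an orthogonal complement. *)
Definition stab x : set G := [set g | forall y, '[x, pi g y] = '[x, y]].

Lemma stab_subgroup x : is_subgroup (stab x).
Proof.
split=> [y|g h sg sh y|g sg y]; first by rewrite orep1.
  by rewrite orepM sg sh.
by rewrite -(sg (pi g^-1%g y)) orepVK.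
Qed.

Lemma stab_null x g : stab x g <-> '[pi g x - x] = 0.
Proof.
split=> [xg|x0 y].
  by rewrite !ipE (ipC (pi g x) x) xg orep_ip; ring.
have : '[pi g x - x, pi g y] = 0 by exact: ip_null.
by rewrite ipBl orep_ip; lra.
Qed.

Lemma stab_orep h x g : stab x (g ^ h)%g -> stab (pi h x) g.
Proof.
move=> s y; rewrite !ip_orepl -(s (pi h^-1%g y)) -!orepM conjgE.
by congr (ip x (pi _ _)); rewrite !mulgA mulgK.
Qed.

Definition fixed A : set V := [set x | A `<=` stab x].

Lemma closed_fixed A : closed_subspace (fixed A).
Proof.
exists [set z | exists g y, A g /\ z = pi g y - y].
apply/seteqP; split=> [x xA _ [g [y [Ag ->]]]|x xA g Ag y].
  by rewrite ipBr (xA g Ag) subrr.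
apply/eqP; rewrite -subr_eq0 -ipBr; apply/eqP; apply: xA.
by exists g, y.
Qed.

Lemma fixed_gen A : fixed (gen A) = fixed A.
Proof.
apply/seteqP; split=> x xA.
  by move=> g /sub_gen /xA.
exact: (gen_sub (stab_subgroup x)).
Qed.

Lemma fixedU A H : fixed (A `|` H) = fixed A `&` fixed H.
Proof.
apply/seteqP; split=> [x xAH|x [xA xH] g [/xA|/xH] //].
by split=> g ?; apply: xAH; [left|right].
Qed.

Lemma fixed1 g x : fixed [set g] x <-> stab x g.
Proof. by split=> [|xg _ ->] //; apply. Qed.

Lemma fixed_orep N x h : normal_subgroup N -> fixed N x -> fixed N (pi h x).
Proof. by move=> [_ NJ] xN g Ng; apply/stab_orep/xN/NJ. Qed.

(** The orthogonal projection onto an invariant closed subspace commutes with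
    [pi h]. *)
Lemma projection_stab W v p h : closed_subspace W ->
  W p -> (forall x, W x -> '[v - p, x] = 0) ->
  (forall x, W x -> W (pi h x)) -> (forall x, W x -> W (pi h^-1%g x)) ->
  stab v h -> stab p h.
Proof.
move=> /closed_subspace_linear[W0 WD WZ] Wp vp Wh WhV vh.
have W' : W (pi h p - p).
  by apply: WD; [exact: Wh|rewrite -scaleN1r; exact: WZ].
have null : '[pi h p - p] = 0.
  set z := pi h p - p; rewrite {1}/z ipBl.
  have -> : '[p, z] = '[v, z] by have := vp _ W'; rewrite ipBl -/z; lra.
  have -> : '[v, z] = '[v, pi h^-1%g z] by rewrite -(vh (pi h^-1%g z)) orepVK.
  rewrite ip_orepl -ipBl -opprB ipNl vp ?oppr0 //; exact: WhV.
have hp y : '[pi h p, y] = '[p, y].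
  by apply/eqP; rewrite -subr_eq0 -ipBl; apply/eqP; exact: ip_null.
by move=> y; rewrite -hp orep_ip.
Qed.

(** Ergodicity is attached to a vector rather than to the representation, so that
    in the Koopman representation the constants do not have to be removed. *)
Definition ergodic_vector v :=
  forall H, finite_index_subgroup H -> forall x, fixed H x -> '[v, x] = 0.

(** The squared norm of the projection of [v] onto the vectors fixed by [g] is at
    most [e]; stated by duality, it composes without mentioning that projection. *)
Definition small_along g v (e : R) :=
  forall x, stab x g -> '[v, x] ^+ 2 <= e * '[x].

Definition infinite_order_mod N g := forall k, (0 < k)%N -> ~ N (g ^+ k)%g.

Section CentralStep.
Variables (N : set G) (z : G).
Hypotheses (nN : normal_subgroup N) (zN : forall g, N [~ z, g]%g).
Hypothesis z_inf : infinite_order_mod N z.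

Let Nz n := gen (N `|` [set (z ^+ n)%g]).

Let nNz n : normal_subgroup (Nz n).
Proof.
apply: normal_adjoin => // g.
exact: (subgX n (commg_subgroup nN g)).
Qed.

Let NzE n : fixed (Nz n) = fixed N `&` [set x | stab x (z ^+ n)%g].
Proof.
rewrite fixed_gen fixedU; congr (_ `&` _).
by apply/seteqP; split=> x /fixed1.
Qed.

(* [W] is directed by divisibility of [n], hence a subspace. *)
Let W : set V := \bigcup_(n in [set n | (0 < n)%N]) fixed (Nz n).

Let W_subspace : subspace W.
Proof.
have lin n := closed_subspace_linear (closed_fixed (Nz n)).
have mulW n m x : fixed (Nz n) x -> fixed (Nz (n * m)) x.
  rewrite !NzE => -[xN xz]; split=> //=.
  by rewrite expgnA; exact: subgX (stab_subgroup x) xz.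
split.
- by exists 1%N => //; case: (lin 1%N).
- move=> x y [n n0 xn] [m m0 ym]; exists (n * m)%N; first by rewrite /= muln_gt0 n0.
  have [_ linD _] := lin (n * m)%N; apply: linD; first exact: mulW.
  by rewrite mulnC; exact: mulW.
- by move=> a x [n n0 xn]; exists n => //; case: (lin n) => _ _; apply.
Qed.

Let U : set V := fixed N `&` orthogonal_to W.

Let closedU : closed_subspace U.
Proof. by apply: closed_subspaceI; [exact: closed_fixed|exists W]. Qed.

Let U_orep h x : U x -> U (pi h x).
Proof.
move=> [xN xW]; split; first exact: fixed_orep.
move=> y [n n0 yn]; rewrite ip_orepl; apply: xW; exists n => //.
exact: fixed_orep.
Qed.

(* The exponent [k.+1] keeps [shift 1 n k] of infinite order modulo [N]. *)
Let shift g n k := (g * z ^+ (n * k.+1))%g.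

Let shift_comm g n k l : N [~ shift g n k, shift g n l]%g.
Proof.
have zX m h : N [~ z ^+ m, h]%g by exact: (subgX m (commg_subgroup nN h)).
have sw (s t : G) : N [~ s, t]%g -> N [~ t, s]%g.
  by case: nN => -[_ _ NV] _ /NV; rewrite invgR.
have [_ cM _] := commg_subgroup nN (shift g n l).
apply: (cM); last exact: zX.
apply: (sw); have [_ {}cM _] := commg_subgroup nN g.
apply: (cM); last exact: zX.
by rewrite /= commgg; case: nN => -[].
Qed.

(* The two translates commute modulo [N], so the projection of [y] onto the
   vectors of [U] fixed by the first is still fixed by the second. It is then fixed
   by their quotient, a power of [z], hence lies in [W] and in its complement. *)
Let shift_orthogonal g n k l x y : (0 < n)%N -> (k < l)%N ->
  U x -> stab x (shift g n k) -> U y -> stab y (shift g n l) -> '[x, y] = 0.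
Proof.
move=> n0 kl Ux xk Uy yl.
pose E := U `&` fixed [set shift g n k].
have closedE : closed_subspace E.
  by apply: closed_subspaceI; [exact: closedU|exact: closed_fixed].
have E_orep h t : N [~ shift g n k, h]%g -> E t -> E (pi h t).
  move=> Nh [Ut /fixed1 tk]; split; first exact: U_orep.
  apply/fixed1/stab_orep; rewrite -(mulKVg (shift g n k) (_ ^ _)%g) -commgEl.
  have [_ sM _] := stab_subgroup t; apply: sM => //.
  by case: Ut => tN _; exact: tN.
have [p Ep yp] := projection y closedE.
have pl : stab p (shift g n l).
  apply: projection_stab closedE Ep yp _ _ yl => t Et; apply: E_orep => //.
  have [_ _ cV] := commgr_subgroup nN (shift g n k).
  by apply: cV; exact: shift_comm.
have [[pN pW] /fixed1 pk] := Ep.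
have Wp : W p.
  exists (n * (l - k))%N; first by rewrite /= muln_gt0 n0 subn_gt0.
  rewrite NzE; split=> //=.
  have [_ sM sV] := stab_subgroup p.
  have := sM _ _ (sV _ pk) pl.
  rewrite /shift invgM !mulgA mulgKV => h.
  have -> : (z ^+ (n * (l - k)) = (z ^+ (n * k.+1))^-1 * z ^+ (n * l.+1))%g.
    have -> : (n * l.+1 = n * k.+1 + n * (l - k))%N by rewrite -mulnDr; congr muln; lia.
    by rewrite expgnDr mulKg.
  exact: h.
have Ex : E x by split=> //; apply/fixed1.
have := yp x Ex; rewrite ipBl (ip_null x (pW p Wp)) subr0 ipC => <-.
by rewrite ipC.
Qed.

(** The vector splits into three parts: [u] orthogonal to [W], the
    projection [p] onto the vectors fixed by [Nz n], and the error [w - p]. The part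
    [p] escapes along every translate [shift g n k] of the [g] given by the hypothesis,
    and [k] is then chosen to suit [u]. *)
Lemma central_step :
  (forall n, (0 < n)%N -> forall v, fixed (Nz n) v -> ergodic_vector v ->
    forall e, 0 < e -> exists g, small_along g v e /\
      (infinite_order_mod (Nz n) g \/ g = 1%g)) ->
  forall v, fixed N v -> ergodic_vector v -> forall e, 0 < e ->
    exists g, small_along g v e /\ infinite_order_mod N g.
Proof.
move=> IH v vN erg e e0.
have [w wW vw] := projection_closure v W_subspace.
(* Three parts, and the square of a sum of three terms costs a factor 3. *)
pose e' := e / 9; have e'0 : 0 < e' by rewrite /e'; lra.
have [y [n n0 yn] wy] := wW _ e'0.
have [p pn vp] := projection v (closed_fixed (Nz n)).
have fixed_invariant h x : fixed (Nz n) x -> fixed (Nz n) (pi h x).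
  exact: fixed_orep.
have wp x : fixed (Nz n) x -> '[w - p, x] = 0.
  move=> xn; have := vp x xn; have := vw x (ex_intro2 _ _ n n0 xn).
  by rewrite !ipE; lra.
have wp_small : '[w - p] <= e'.
  apply: le_trans wy.
  have [_ linD linZ] := closed_subspace_linear (closed_fixed (Nz n)).
  have py : fixed (Nz n) (p - y) by apply: linD; rewrite // -scaleN1r; exact: linZ.
  have -> : '[w - y] = '[w - p] + '[p - y] + 2 * '[w - p, p - y].
    by rewrite !ipE (ipC p w) (ipC y w) (ipC y p); ring.
  by rewrite (wp _ py) mulr0 addr0 lerDl; exact: ip_ge0.
(* Projecting a vector fixed by [H] onto the vectors fixed by the normal subgroup
   [Nz n] leaves it fixed by [H]. *)
have erg_p : ergodic_vector p.
  move=> H fH x xH; have [x' x'n xx'] := projection x (closed_fixed (Nz n)).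
  have -> : '[p, x] = '[v, x'].
    have := vp _ x'n; have := xx' _ pn; rewrite !ipE (ipC x p) (ipC x' p); lra.
  apply: erg fH _ _ => g Hg.
  apply: projection_stab (closed_fixed _) x'n xx' _ _ (xH g Hg) => t;
    exact: fixed_invariant.
have [g [g_small g_order]] := IH n n0 p pn erg_p e' e'0.
have shift_order k : infinite_order_mod N (shift g n k).
  move=> i i0 Ni; case: g_order => [/(_ i i0)|g1]; last first.
    apply: (z_inf (k := (n * k.+1 * i)%N)); first by rewrite !muln_gt0 n0 i0.
    by move: Ni; rewrite /shift g1 mul1g -expgnA.
  apply; apply: (eqmod_mem (nNz n)) (sub_gen (or_introl Ni)).
  apply: (eqmodX (nNz n)).
  have [gM1 gMM gMV] := gen_subgroup (N `|` [set (z ^+ n)%g]).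
  rewrite /eqmod /shift invgM -mulgA mulVg mulg1; apply: gMV.
  rewrite expgnA; apply: (subgX k.+1 (nNz n).1).
  by apply: sub_gen; right.
have shift_small k : small_along (shift g n k) p e'.
  move=> x xk; have [x' x'n xx'] := projection x (closed_fixed (Nz n)).
  have -> : '[p, x] = '[p, x'].
    by have := xx' _ pn; rewrite !ipE (ipC x p) (ipC x' p); lra.
  apply: le_trans (ler_wpM2l (ltW e'0) (projection_le x'n xx')).
  apply: g_small.
  have x'k : stab x' (shift g n k).
    apply: projection_stab (closed_fixed _) x'n xx' _ _ xk => t;
      exact: fixed_invariant.
  have [_ sM sV] := stab_subgroup x'.
  rewrite -(mulgK (z ^+ (n * k.+1)) g)%g; apply: sM => //; apply: sV.
  rewrite expgnA; apply: (subgX k.+1 (stab_subgroup x')).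
  by move: x'n; rewrite NzE => -[].
have [u uE] : exists u, u = v - w by exists (v - w).
have Uu : U u.
  rewrite uE; split=> // h Nh y'.
  have wN : '[w, pi h y' - y'] = 0.
    apply: ip_approx => e1 /wW[t [m m0 tm] wt]; exists t; split=> //.
    by move: tm; rewrite NzE => -[/(_ h Nh) th _]; rewrite ipBr th subrr.
  have := vN h Nh y'; move: wN; rewrite !ipE; lra.
pose E k := U `&` fixed [set shift g n k].
have closedE k : closed_subspace (E k).
  by apply: closed_subspaceI; [exact: closedU|exact: closed_fixed].
have /choice[q qP] : forall k, exists q, E k q /\ forall x, E k x -> '[u - q, x] = 0.
  by move=> k; have [q Eq uq] := projection u (closedE k); exists q.
have [k qk] : exists k, '[q k] <= e'.
  apply: (bessel (u := u)) => // [k l kl|k]; last first.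
    by have [Eq uq] := qP k; exact: uq.
  have [[Uk /fixed1 fk] _] := qP k; have [[Ul /fixed1 fl] _] := qP l.
  exact: shift_orthogonal n0 kl Uk fk Ul fl.
exists (shift g n k); split=> // x xk.
have u_small : '[u, x] ^+ 2 <= e' * '[x].
  have [x' Ux' xx'] := projection x closedU.
  have x'k : stab x' (shift g n k).
    by apply: projection_stab closedU Ux' xx' _ _ xk => t; exact: U_orep.
  have [_ /(_ x' (conj Ux' ((fixed1 _ _).2 x'k)))] := qP k.
  have := xx' u Uu; rewrite !ipE (ipC x u) (ipC x' u) => h1 h2.
  have -> : '[u, x] = '[q k, x'] by lra.
  apply: (le_trans (cauchy_schwarz _ _)).
  by apply: ler_pM => //; [exact: ip_ge0|exact: ip_ge0|exact: projection_le Ux' xx'].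
have wp_x : '[w - p, x] ^+ 2 <= e' * '[x].
  apply: (le_trans (cauchy_schwarz _ _)).
  by apply: ler_wpM2r => //; exact: ip_ge0.
have p_x := shift_small k x xk.
have -> : '[v, x] = '[u, x] + '[w - p, x] + '[p, x] by rewrite uE !ipE; ring.
have -> : e * '[x] = 9 * (e' * '[x]) by rewrite /e'; field.
have sq3 (a b c : R) : (a + b + c) ^+ 2 <= 3 * (a ^+ 2 + b ^+ 2 + c ^+ 2).
  have := sqr_ge0 (a - b); have := sqr_ge0 (a - c); have := sqr_ge0 (b - c); nra.
by apply: (le_trans (sq3 _ _ _)); lra.
Qed.

End CentralStep.

(** The induction hypothesis along the chain. In the second alternative [v] is
    null, and [1] stands for an element along which it is small. *)
Definition escapes L := forall N, normal_subgroup N -> finite_mod L N ->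
  forall v, fixed N v -> ergodic_vector v -> forall e, 0 < e ->
    exists g, small_along g v e /\
      (infinite_order_mod N g \/ g = 1%g /\ finite_mod [set: G] N).

Lemma escapes_setT : escapes [set: G].
Proof.
move=> N nN fN v vN erg e e0; exists 1%g; split; last by right.
move=> x _; have -> : '[v, x] = 0.
  by apply: ip_null; apply: erg vN; exact: finite_mod_index.
by rewrite expr0n mulr_ge0 ?(ltW e0) ?ip_ge0.
Qed.

(** If a power of [x] lies in [N], then [gen (L `|` [set x])] is itself finite modulo
    [N]. Otherwise a central power of [x] has infinite order, and adjoining any of its
    positive powers to [N] makes [gen (L `|` [set x])] finite modulo the result. *)
Lemma escapes_adjoin L (x : G) : normal_subgroup L -> (forall g, L [~ x, g]%g) ->
  escapes (gen (L `|` [set x])) -> escapes L.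
Proof.
move=> nL Lx esc N nN fLN v vN erg e e0.
have [[K [K0 NxK]]|x_inf] := pselect (exists K, (0 < K)%N /\ N (x ^+ K)%g).
  by apply: esc => //; exact: finite_mod_adjoin fLN K0 NxK.
have [K K0 xK] := central_power nL nN Lx fLN.
have z_inf : infinite_order_mod N (x ^+ K)%g.
  move=> k k0 Nk; apply: x_inf; exists (K * k)%N.
  by rewrite muln_gt0 K0 k0 expgnA.
suff [g [gs go]] : exists g, small_along g v e /\ infinite_order_mod N g.
  by exists g; split=> //; left.
apply: (central_step nN xK z_inf) vN erg e e0 => n n0 v' v'n erg' e' e'0.
have nNz : normal_subgroup (gen (N `|` [set (x ^+ K) ^+ n]))%g.
  by apply: normal_adjoin => // g; exact: (subgX n (commg_subgroup nN g)).
have Nsub : N `<=` gen (N `|` [set (x ^+ K) ^+ n])%g.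
  by move=> y Ny; apply: sub_gen; left.
have [|g [gs go]] := esc _ nNz _ v' v'n erg' e' e'0.
  apply: (finite_mod_adjoin (K := (K * n)%N)) => //.
  - exact: finite_modS Nsub fLN.
  - by rewrite muln_gt0 K0.
  - by rewrite expgnA; apply: sub_gen; right.
by exists g; split=> //; case: go => [|[]]; [left|right].
Qed.

Lemma polycentral_escapes L : polycentral L -> escapes L -> escapes [set 1%g].
Proof.
elim=> [//|{}L x pL IH Lx escL]; apply: IH.
by apply: escapes_adjoin escL => //; exact: polycentral_normal.
Qed.

Theorem nilpotent_escape : infinite_set [set: G] -> finitely_generated G ->
  nilpotent_group G -> forall v, ergodic_vector v -> forall e, 0 < e ->
  exists g, small_along g v e /\ infinite_order_mod [set 1%g] g.
Proof.
move=> infG fgG nG v erg e e0.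
have esc := polycentral_escapes (nilpotent_polycentral fgG nG) escapes_setT.
have n1 : normal_subgroup [set 1%g : G] by exact/polycentral_normal/polycentral1.
have f1 : finite_mod [set 1%g : G] [set 1%g].
  by exists [:: 1%g] => _ ->; exists 1%g; rewrite ?inE // /eqmod /= invg1 mulg1.
have v1 : fixed [set 1%g] v by apply/fixed1; case: (stab_subgroup v).
have [g [gs [go|[_ [s sG]]]]] := esc _ n1 f1 v v1 erg e e0; first by exists g.
exfalso; apply: infG; apply: (@sub_finite_set _ _ [set` s]); last exact: finite_seq.
move=> y _; have [t ts] := sG y I.
by rewrite /eqmod /= => /mulg1_eq; rewrite invgK => <-.
Qed.

End Escape.

(** * Complex Hilbert spaces *)

Section ComplexHilbert.
Local Open Scope complex_scope.
Variables (R : realType) (V : hilbertSpace R).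

(** A separate name for [V], to carry its structure of real vector space. *)
Definition realification : Type := V.

HB.instance Definition _ := GRing.Zmodule.on realification.

Let rscale (a : R) (x : realification) : realification := (a%:C *: (x : V)).

Let rscaleA a b x : rscale a (rscale b x) = rscale (a * b) x.
Proof. by rewrite /rscale scalerA rmorphM. Qed.
Let rscale1 : left_id 1 rscale.
Proof. by move=> x; rewrite /rscale scale1r. Qed.
Let rscaleDr : right_distributive rscale +%R.
Proof. by move=> a x y; rewrite /rscale; exact: scalerDr. Qed.
Let rscaleDl v : {morph rscale^~ v : a b / a + b}.
Proof. by move=> a b; rewrite /rscale raddfD; exact: scalerDl. Qed.

HB.instance Definition _ := GRing.Zmodule_isLmodule.Build R realification
  rscaleA rscale1 rscaleDr rscaleDl.

Definition re_inner (x y : realification) : R := complex.Re (inner V x y).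

Lemma inner_conj (x y : V) : inner V y x = (inner V x y)^*.
Proof. by rewrite (hermC (inner V) y x) expr0 mul1r. Qed.

Let re_innerC x y : re_inner x y = re_inner y x.
Proof. by rewrite /re_inner inner_conj; case: (inner V y x). Qed.

Let re_inner_linear a x y z : re_inner (a *: x + y) z = a * re_inner x z + re_inner y z.
Proof.
rewrite /re_inner (linearPl (inner V) z a%:C x y) raddfD /=; congr (_ + _).
by case: (inner V x z) => b c /=; rewrite mul0r subr0.
Qed.

Lemma hnormE (v : V) : `|v| = (hnorm v)%:C.
Proof. by rewrite /hnorm RRe_real. Qed.

Lemma hnorm_ge0 (v : V) : 0 <= hnorm v.
Proof. by have := normr_ge0 v; rewrite hnormE lecR. Qed.

Lemma hnorm_sqr (v : V) : hnorm v ^+ 2 = re_inner v v.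
Proof. by rewrite /re_inner -hilbert_normE hnormE -rmorphXn. Qed.

Let re_inner_ge0 x : 0 <= re_inner x x.
Proof. by rewrite -hnorm_sqr sqr_ge0. Qed.

Let re_inner_complete (s : nat -> realification) :
  (forall i j, (i <= j)%N -> re_inner (s i - s j) (s i - s j) <= 4^-1 ^+ i) ->
  exists w, forall e, 0 < e ->
    exists i, re_inner (w - s i) (w - s i) <= e /\ 4^-1 ^+ i <= e.
Proof.
move=> s_cauchy.
have normlt (x : V) (e : R) : 0 < e -> re_inner x x < e ^+ 2 -> `|x| < e%:C.
  move=> e0; rewrite -hnorm_sqr hnormE ltcR.
  by rewrite ltr_sqr ?nnegrE ?hnorm_ge0 ?ltW.
have : cvg ((s : nat -> V) @ \oo).
  apply: cauchy_cvg; apply: cauchy_exP => e e0.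
  have e_real : e = (complex.Re e)%:C by rewrite RRe_real // gtr0_real.
  have re0 : 0 < complex.Re e by move: e0; rewrite {1}e_real ltcR.
  have [i ie] := pow4_small (divr_gt0 (exprn_gt0 2 re0) (ltr0n _ 2)).
  exists (s i); exists i => // j /= ij.
  rewrite -ball_normE /= e_real; apply: normlt => //.
  apply: le_lt_trans (s_cauchy i j ij) _; apply: (le_lt_trans ie).
  by rewrite ltr_pdivrMr // ltr_pMr ?exprn_gt0 // ltr1n.
move=> /cvg_ex[w sw]; exists w => e e0.
have se : 0 < (Num.sqrt e)%:C by rewrite ltcR sqrtr_gt0.
have [i0 i0e] := pow4_small e0.
have /cvgrPdist_lt/(_ _ se)[N _ wN] := sw.
exists (maxn i0 N); split; last first.
  apply: le_trans i0e; apply: ler_wiXn2l; last exact: leq_maxl.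
    by rewrite invr_ge0.
  by rewrite invf_le1 // ler1n.
have := wN _ (leq_maxr i0 N); rewrite /= -hnorm_sqr hnormE ltcR.
rewrite -[X in _ <= X](sqr_sqrtr (ltW e0)) ler_sqr ?nnegrE ?hnorm_ge0 ?sqrtr_ge0 //.
exact: ltW.
Qed.

Definition realHilbert : semiHilbert R :=
  SemiHilbert re_innerC re_inner_linear re_inner_ge0 re_inner_complete.

Variable G : groupType.
Variable pi : unitaryRep G V.

Definition realRep : orthogonalRep G realHilbert.
Proof.
refine (@OrthogonalRep R G realHilbert (fun g v => pi g v) _ _ _ _).
- exact: rep1.
- exact: repM.
- by move=> g a v w; exact: linearP.
- by move=> g v w; rewrite /= /re_inner rep_inner.
Defined.

(** The form is now definite, so that testing against all vectors gives equality. *)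
Lemma fixed_realRep (H : set G) : fixed realRep H = fixed_vectors pi H.
Proof.
apply/seteqP; split=> x xH g Hg.
  have /stab_null xg := xH g Hg.
  apply/eqP; rewrite -subr_eq0 -normr_eq0 hnormE.
  suff -> : hnorm (pi g x - x) = 0 by [].
  by apply/eqP; rewrite -sqrf_eq0 hnorm_sqr; apply/eqP.
by move=> y; rewrite -[in LHS](xH g Hg); exact: (orep_ip realRep).
Qed.

(** Since the space of fixed vectors is complex, orthogonality for the real part
    of the inner product, applied to [u] and ['i *: u], gives complex orthogonality. *)
Lemma orth_proj_fixed (C : set G) v :
  is_orth_proj (fixed_vectors pi C) v (orth_proj (fixed_vectors pi C) v).
Proof.
apply: (xgetPex v (P := [set w | is_orth_proj (fixed_vectors pi C) v w])).
have [p] := projection (v : realHilbert) (closed_fixed realRep C).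
rewrite fixed_realRep => pC vp; exists p; split=> // u uC.
have re := vp u uC.
have iu : fixed_vectors pi C ('i *: u) by move=> g Cg; rewrite linearZ /= uC.
have := vp _ iu; move: re; rewrite /= /re_inner (linearZr_LR (inner V)) /=.
case: (inner V (v - p) u) => b c /= ->.
by rewrite mul0r sub0r mulN1r opprK => ->.
Qed.

(** Smallness tested on the projection [w] itself bounds the norm of [w]. *)
Lemma orth_proj_small (g : G) v e : 0 <= e ->
  small_along realRep g (v : realHilbert) (e ^+ 2) ->
  hnorm (orth_proj (fixed_vectors pi (gen [set g])) v) <= e.
Proof.
move=> e0 small; have [] := orth_proj_fixed (gen [set g]) v.
set w := orth_proj _ v => wC /(_ w wC) vw.
have wg : stab realRep w g.
  by apply/fixed1; rewrite -fixed_gen fixed_realRep.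
have vwE : re_inner v w = re_inner w w.
  apply/eqP; rewrite -subr_eq0; have := @ipBl R realHilbert v w w.
  by rewrite /= => <-; rewrite /re_inner vw.
have := small w wg; rewrite /= vwE -hnorm_sqr => h.
have [->//|w0] := eqVneq (hnorm w) 0.
have wpos : 0 < hnorm w by rewrite lt_def w0 hnorm_ge0.
move: h; rewrite expr2 ler_pM2r ?exprn_gt0 //.
by rewrite ler_sqr ?nnegrE ?hnorm_ge0.
Qed.

Lemma ergodic_realRep : totally_ergodic_rep pi ->
  forall v, ergodic_vector realRep v.
Proof.
move=> te v H fH x; rewrite fixed_realRep te // => ->; exact: ip0r.
Qed.

End ComplexHilbert.

Lemma gen_infinite (G : groupType) (g : G) :
  infinite_order_mod [set 1%g] g -> infinite_set (gen [set g]).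
Proof.
move=> g_inf.
have lt m n : (m < n)%N -> (g ^+ m)%g <> (g ^+ n)%g.
  move=> mn gmn; apply: (g_inf (n - m)%N); first by rewrite subn_gt0.
  by rewrite /= expgnFr 1?ltnW // gmn mulgV.
have pow_inj : {in [set: nat] &, injective (fun n => g ^+ n)%g}.
  move=> m n _ _ gmn; have [/lt|/lt|//] := ltngtP m n; first by move/(_ gmn).
  by move/(_ (esym gmn)).
apply/infiniteP; rewrite -(card_le_eql (inj_card_eq pow_inj)).
by apply: subset_card_le => _ [n _ <-]; apply: subgX (gen_subgroup _) _; exact: sub_gen.
Qed.

Theorem nilpotent_cyclic_escape (R : realType) (G : groupType) :
  infinite_set [set: G] -> finitely_generated G -> nilpotent_group G ->
  cyclic_escape_property R G.
Proof.
move=> infG fgG nG; split=> //; first exact: finitely_generated_countable.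
move=> V pi te v; apply/eqP; rewrite eq_le; apply/andP; split; last first.
  apply: le_ereal_inf_tmp => _ [C _ <-]; rewrite lee_fin; exact: hnorm_ge0.
apply/lee_addgt0Pr => e e0; rewrite add0e.
have [g [gs g_inf]] := nilpotent_escape (pi := realRep pi) infG fgG nG
  (ergodic_realRep te v) (exprn_gt0 2 e0).
apply: le_trans (ereal_inf_lbound _) _.
  exists (gen [set g]); last by [].
  by split; [exists g|exact: gen_infinite].
by rewrite lee_fin; exact: orth_proj_small (ltW e0) gs.
Qed.

(** * Completeness of the square-integrable functions *)

Section RieszFischer.
Context (R : realType) (d : measure_display) (T : measurableType d).
Variable mu : probability T R.

Lemma sum_half_lt (n : nat) :
  \sum_(0 <= i < n) (2 * 2^-1 ^+ i) = 4 - 4 * 2^-1 ^+ n :> R.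
Proof.
elim: n => [|n IH]; first by rewrite big_geq // expr0; lra.
by rewrite big_nat_recr //= IH exprS; lra.
Qed.

Variable s : nat -> T -> R.
Hypothesis ms : forall i, measurable_fun [set: T] (s i).
Hypothesis s_cauchy : forall i j, (i <= j)%N ->
  (\int[mu]_x ((s i x - s j x) ^+ 2)%:E <= (4^-1 ^+ i)%:E)%E.

(* Since [mu] has mass 1, the mean of [D i] is controlled by its mean square: the
   weight [2 ^+ i] balances the decay of the mean squares against the constant. *)
Let D i x : R := `|s i.+1 x - s i x|.

Let mD i : measurable_fun [set: T] (D i).
Proof. by apply: measurableT_comp => //; exact: measurable_funB. Qed.

Let int_D i : (\int[mu]_x (D i x)%:E <= (2 * 2^-1 ^+ i)%:E)%E.
Proof.
have mB : measurable_fun [set: T] (fun x => (s i x - s i.+1 x) ^+ 2).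
  by apply: measurable_funX; exact: measurable_funB.
apply: (@le_trans _ _ (\int[mu]_x
    ((2 ^+ i)%:E * ((s i x - s i.+1 x) ^+ 2)%:E + (2^-1 ^+ i)%:E))%E).
  apply: ge0_le_integral => //.
  - by move=> x _; rewrite lee_fin /D.
  - exact/measurable_EFinP.
  - apply: emeasurable_funD; last exact: measurable_cst.
    by apply: emeasurable_funM; [exact: measurable_cst|exact/measurable_EFinP].
  - move=> x _; rewrite -EFinM -EFinD lee_fin /D distrC.
    set a := `|_|; have -> : (s i x - s i.+1 x) ^+ 2 = a ^+ 2.
      by rewrite /a real_normK ?num_real.
    have p0 : 0 < 2 ^+ i :> R by rewrite exprn_gt0.
    rewrite exprVn; set p := 2 ^+ i in p0 *.
    have -> : p * a ^+ 2 + p^-1 = a + ((p * a - 2^-1) ^+ 2 + 3 / 4) / p.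
      by field; rewrite gt_eqF.
    by rewrite lerDl divr_ge0 ?(ltW p0) // addr_ge0 ?sqr_ge0 // divr_ge0.
rewrite ge0_integralD //.
- rewrite ge0_integralZl //.
  + rewrite integral_cst // [X in (_ + _ * X)%E]probability_setT mule1.
    have -> : (2 * 2^-1 ^+ i)%:E =
        ((2 ^+ i)%:E * (4^-1 ^+ i)%:E + (2^-1 ^+ i)%:E)%E :> \bar R.
      rewrite -EFinM -EFinD -exprMn; have -> : 2 * 4^-1 = 2^-1 :> R by lra.
      by congr EFin; rewrite mulr_natl mulr2n.
    apply: leeD2r; apply: lee_wpmul2l; first by rewrite lee_fin exprn_ge0.
    exact: s_cauchy.
  + exact/measurable_EFinP.
  + by move=> x _; rewrite lee_fin sqr_ge0.
- by move=> x _; rewrite mule_ge0 // lee_fin ?sqr_ge0 ?exprn_ge0.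
- by apply: emeasurable_funM; [exact: measurable_cst|exact/measurable_EFinP].
Qed.

Let ae_sum : {ae mu, forall x, ((\sum_(0 <= i <oo) (D i x)%:E)%E \is a fin_num)}.
Proof.
have mDe i : measurable_fun [set: T] (fun x => (D i x)%:E) by exact/measurable_EFinP.
have D0 i x : (0 <= (D i x)%:E)%E by rewrite lee_fin /D.
have : mu.-integrable [set: T] (fun x => \sum_(0 <= i <oo) (D i x)%:E)%E.
  apply/integrableP; split.
    exact: ge0_emeasurable_sum.
  under eq_integral do rewrite gee0_abs ?nneseries_ge0 //.
  rewrite integral_nneseries //.
  apply: (@le_lt_trans _ _ 4%:E); last exact: ltry.
  apply: lime_le.
    by apply: is_cvg_nneseries => n _ _; apply: integral_ge0.
  apply: nearW => n; apply: (@le_trans _ _ (\sum_(0 <= i < n) (2 * 2^-1 ^+ i)%:E)%E).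
    by apply: lee_sum => i _; exact: int_D.
  rewrite sumEFin lee_fin sum_half_lt lerBlDr lerDl.
  by rewrite mulr_ge0 // exprn_ge0.
by move=> /(integrable_ae measurableT); apply: filterS => x; apply.
Qed.

(* The upper limit is measurable whether or not the sequence converges. *)
Let lim x : R := fine (limn_esup (fun i => (s i x)%:E)).

Let ae_lim : {ae mu, forall x, s ^~ x @ \oo --> lim x}.
Proof.
apply: filterS ae_sum => x sum_fin.
have D0 i : (0 <= (D i x)%:E)%E by rewrite lee_fin /D.
have scvg : cvgn (fun i => s i x).
  have : cvgn (series (telescope (s ^~ x))).
    apply: normed_cvg; apply: nondecreasing_is_cvgn.
      by apply: (nondecreasing_series (u_ := fun k => D k x)) => k _ _; exact: normr_ge0.
    exists (fine (\sum_(0 <= i <oo) (D i x)%:E)%E) => _ [n _ <-].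
    rewrite -lee_fin fineK // /series /= -sumEFin.
    exact: (nneseries_lim_ge (u_ := fun i => (D i x)%:E) n).
  rewrite telescopeK => h.
  have -> : (fun i => s i x) = (fun i => s i x - s 0%N x) + cst (s 0%N x).
    by apply/funext => n; rewrite /GRing.add /= subrK.
  exact: is_cvgD h (is_cvg_cst _).
move/cvg_ex: (scvg) => [l sl].
have : (fun i => (s i x)%:E) @ \oo --> l%:E by apply/cvg_EFin => //; exact: nearW.
by move=> /cvg_limn_einf_sup[_]; rewrite /lim => ->.
Qed.

(** The increments are summable in mean, hence the sequence converges almost
    everywhere, and Fatou's lemma carries the bounds to the limit. *)
Lemma riesz_fischer : exists2 f : T -> R, measurable_fun [set: T] f &
  forall i, (\int[mu]_x ((f x - s i x) ^+ 2)%:E <= (4^-1 ^+ i)%:E)%E.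
Proof.
have mlim : measurable_fun [set: T] lim.
  apply: (measurableT_comp (fine_measurable _)) => //.
  by apply: measurable_fun_limn_esup => i; exact/measurable_EFinP.
exists lim => // i.
pose F j x : \bar R := ((s i x - s j x) ^+ 2)%:E.
have mF j : measurable_fun [set: T] (F j).
  by apply/measurable_EFinP; apply: measurable_funX; exact: measurable_funB.
have F0 j x : (0 <= F j x)%E by rewrite lee_fin sqr_ge0.
apply: (@le_trans _ _ (\int[mu]_x limn_einf (F ^~ x))%E).
  apply: ae_ge0_le_integral => //.
  - by move=> x _; rewrite lee_fin sqr_ge0.
  - by apply/measurable_EFinP; apply: measurable_funX; exact: measurable_funB.
  - move=> x _; rewrite limn_einf_lim; apply: lime_ge; first exact: is_cvg_einfs.
    by apply: nearW => n; apply: le_ereal_inf_tmp => _ [k _ <-].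
  - apply: measurableT_comp => //.
    by apply: measurable_fun_limn_esup => j; exact: measurableT_comp.
  - apply: filterS ae_lim => x sx _.
    have : F ^~ x @ \oo --> ((s i x - lim x) ^+ 2)%:E.
      apply/cvg_EFin; first exact: nearW.
      rewrite /comp /F /=.
      by apply: (@cvgM _ _ \oo _ (fun j => s i x - s j x) (fun j => s i x - s j x));
        apply: cvgB => //; exact: cvg_cst.
    by move=> /cvg_limn_einf_sup[-> _]; rewrite lee_fin -sqrrN opprB.
apply: le_trans (fatou mu measurableT mF _) _ => //.
rewrite limn_einf_lim; apply: lime_le; first exact: is_cvg_einfs.
apply: nearW => n; apply: le_trans (s_cauchy (leq_maxl i n)).
apply: ereal_inf_lbound; exists (maxn i n) => //=; exact: leq_maxr.
Qed.

End RieszFischer.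

(** * The semi-Hilbert space of square-integrable functions *)

Section L2.
Context (R : realType) (d : measure_display) (T : measurableType d).
Variable mu : probability T R.

Notation L2 := (LfunType mu (lee1n 2)).

Lemma Lfun2_of_sqr (f : T -> R) : measurable_fun [set: T] f ->
  (\int[mu]_x ((f x) ^+ 2)%:E < +oo)%E -> f \in Lfun mu 2%:E.
Proof.
move=> mf f2; rewrite inE; apply/andP; split; rewrite inE //=.
rewrite /finite_norm unlock /Lnorm; apply: poweR_lty.
under eq_integral => x _ do rewrite /= powR_mulrn ?normr_ge0 // real_normK ?num_real //.
exact: f2.
Qed.

Lemma integrable_mul (f g : L2) : mu.-integrable [set: T] (fun x => (f x * g x)%:E).
Proof. by apply/Lfun1_integrable; apply: Lfun2_mul_Lfun1; exact: LfunP. Qed.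

Definition L2_ip (f g : L2) : R := \int[mu]_x (f x * g x).

Let L2_ipC f g : L2_ip f g = L2_ip g f.
Proof. by apply: eq_Rintegral => x _; rewrite mulrC. Qed.

Let L2_ip_linear a (f g h : L2) : L2_ip (a *: f + g) h = a * L2_ip f h + L2_ip g h.
Proof.
rewrite /L2_ip.
transitivity (\int[mu]_x ((a *: f) x * h x + g x * h x)).
  by apply: eq_Rintegral => x _; rewrite -mulrDl.
rewrite RintegralD //; [congr (_ + _)|exact: integrable_mul|exact: integrable_mul].
rewrite -RintegralZl //; last exact: integrable_mul.
by apply: eq_Rintegral => x _; rewrite mulrA.
Qed.

Let L2_ip_ge0 f : 0 <= L2_ip f f.
Proof. by apply: Rintegral_ge0 => x _; rewrite -expr2 sqr_ge0. Qed.

Lemma integral_sqrE (f : L2) : (\int[mu]_x ((f x) ^+ 2)%:E = (L2_ip f f)%:E)%E.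
Proof.
rewrite /L2_ip /Rintegral fineK; first by apply: eq_integral => x _; rewrite expr2.
by apply: integrable_fin_num => //; exact: integrable_mul.
Qed.

Let L2_ip_complete (s : nat -> L2) :
  (forall i j, (i <= j)%N -> L2_ip (s i - s j) (s i - s j) <= 4^-1 ^+ i) ->
  exists w, forall e, 0 < e ->
    exists i, L2_ip (w - s i) (w - s i) <= e /\ 4^-1 ^+ i <= e.
Proof.
move=> s_cauchy.
have [i|i j ij|f mf fs] := @riesz_fischer R d T mu (fun i => s i).
- exact: measurable_funPT.
- rewrite -[leLHS]/(\int[mu]_x (((s i - s j) x) ^+ 2)%:E)%E integral_sqrE.
  by rewrite lee_fin s_cauchy.
have f0 : f \- s 0%N \in Lfun mu 2%:E.
  apply: Lfun2_of_sqr; first by apply: measurable_funB => //; exact: measurable_funPT.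
  by apply: le_lt_trans (fs 0%N) _; exact: ltry.
exists (Lfun_Sub (lee1n 2) f0 + s 0%N) => e e0; have [i ie] := pow4_small e0.
exists i; split=> //; apply: le_trans ie.
rewrite -lee_fin -integral_sqrE; apply: le_trans (fs i).
rewrite le_eqVlt; apply/orP; left; apply/eqP; apply: eq_integral => x _.
by rewrite -[(_ - s i) x]/((f x - s 0%N x) + s 0%N x - s i x) subrK.
Qed.

Definition L2_space : semiHilbert R :=
  SemiHilbert L2_ipC L2_ip_linear L2_ip_ge0 L2_ip_complete.

Lemma L2_null (f : L2) : L2_ip f f = 0 -> {ae mu, forall x, f x = 0}.
Proof.
move=> f0.
have : ae_eq mu [set: T] (fun x => ((f x) ^+ 2)%:E) (cst 0%E).
  apply/(ae_eq_integral_abs mu measurableT).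
    by apply/measurable_EFinP; apply: measurable_funX; exact: measurable_funPT.
  under eq_integral do rewrite gee0_abs ?lee_fin ?sqr_ge0 //.
  by rewrite integral_sqrE f0.
by apply: filterS => x /(_ I) [] /eqP; rewrite sqrf_eq0 => /eqP.
Qed.

Lemma L2_integrable (f : L2) : mu.-integrable [set: T] (EFin \o f).
Proof.
apply/Lfun1_integrable; apply: Lfun_subset12; last exact: LfunP.
exact: fin_num_measure.
Qed.

Lemma cst_Lfun2 (c : R) : cst c \in Lfun mu 2%:E.
Proof. exact: Lfun_cst. Qed.

Lemma indic_Lfun2 (B : set T) : measurable B -> (\1_B : T -> R) \in Lfun mu 2%:E.
Proof.
move=> mB; apply: Lfun2_of_sqr; first exact: measurable_indic.
apply: (@le_lt_trans _ _ (\int[mu]_x (\1_B x)%:E)%E).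
  apply: ge0_le_integral => //.
  - by apply/measurable_EFinP; apply: measurable_funX; exact: measurable_indic.
  - by apply/measurable_EFinP; exact: measurable_indic.
  - by move=> x _; rewrite lee_fin indicE; case: (x \in B); rewrite ?expr1n ?expr0n.
rewrite integral_indic // setIT.
by apply: le_lt_trans (probability_le1 _ mB) _; exact: ltry.
Qed.

Definition centered_indic (B : set T) (mB : measurable B) : L2 :=
  Lfun_Sub (lee1n 2) (indic_Lfun2 mB) -
  Lfun_Sub (lee1n 2) (cst_Lfun2 (fine (mu B))).

Lemma mu_fine (B : set T) : measurable B -> (fine (mu B))%:E = mu B.
Proof. by move=> mB; rewrite fineK //; exact: fin_num_measure. Qed.

Lemma Rintegral_indic (B : set T) : measurable B -> \int[mu]_x (\1_B x) = fine (mu B).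
Proof. by move=> mB; rewrite /Rintegral integral_indic // setIT. Qed.

Lemma integrable_indic1 (B : set T) : measurable B ->
  mu.-integrable [set: T] (EFin \o (\1_B : T -> R)).
Proof.
by move=> mB; have := L2_integrable (Lfun_Sub (lee1n 2) (indic_Lfun2 mB)).
Qed.

Lemma integrable_cst1 (c : R) : mu.-integrable [set: T] (EFin \o cst c).
Proof. exact: finite_measure_integrable_cst. Qed.

Lemma Rintegral_centered (B : set T) (mB : measurable B) :
  \int[mu]_x (centered_indic mB x) = 0.
Proof.
rewrite -[LHS]/(\int[mu]_x (\1_B x - cst (fine (mu B)) x)) RintegralB //.
- rewrite Rintegral_indic // Rintegral_cst // [X in _ * fine X]probability_setT.
  by rewrite mulr1 subrr.
- exact: integrable_indic1.
- exact: integrable_cst1.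
Qed.

Lemma ip_centered (A B : set T) (mA : measurable A) (mB : measurable B) :
  A `<=` B ->
  L2_ip (centered_indic mA) (centered_indic mB) = fine (mu A) * (1 - fine (mu B)).
Proof.
move=> AB; rewrite /L2_ip.
have id2 : forall x, \1_A x * \1_B x = \1_A x :> R.
  move=> x; rewrite !indicE; case: (boolP (x \in A)) => [|_]; last by rewrite mul0r.
  by move=> /set_mem/AB/mem_set ->; rewrite mulr1.
transitivity (\int[mu]_x
    ((1 - fine (mu B)) * \1_A x - fine (mu A) * centered_indic mB x)).
  apply: eq_Rintegral => x _.
  rewrite -[centered_indic mA x]/(\1_A x - fine (mu A)).
  rewrite -[centered_indic mB x]/(\1_B x - fine (mu B)).
  rewrite mulrBl mulrBr id2; ring.
rewrite RintegralB //.
- rewrite !RintegralZl //; [|exact: L2_integrable|exact: integrable_indic1].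
  by rewrite Rintegral_centered Rintegral_indic // mulr0 subr0 mulrC.
- exact: (L2_integrable ((1 - fine (mu B)) *: Lfun_Sub (lee1n 2) (indic_Lfun2 mA))).
- exact: (L2_integrable (fine (mu A) *: centered_indic mB)).
Qed.

End L2.

(** * The Koopman representation *)

Section Koopman.
Context (R : realType) (d : measure_display) (X : measurableType d).
Variables (mu : probability X R) (G : groupType) (a : pmpAction G mu).

Notation L2 := (LfunType mu (lee1n 2)).

Lemma actK g x : a g (a g^-1%g x) = x.
Proof. by rewrite -Defs.actM mulgV Defs.act1. Qed.

Lemma actVK g x : a g^-1%g (a g x) = x.
Proof. by rewrite -Defs.actM mulVg Defs.act1. Qed.

Lemma act_image g (B : set X) : a g @` B = a g^-1%g @^-1` B.
Proof.
apply/seteqP; split=> [_ [x Bx <-]|x Bx] /=; first by rewrite actVK.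
by exists (a g^-1%g x) => //; rewrite actK.
Qed.

Lemma measurable_act_preimage g (B : set X) : measurable B -> measurable (a g @^-1` B).
Proof. by move=> mB; rewrite -[_ @^-1` _]setTI; exact: act_measurable. Qed.

Let pushforward_act g (F : X -> \bar R) :
  (\int[pushforward mu (a g)]_x F x = \int[mu]_x F x)%E.
Proof.
apply: eq_measure_integral; first exact: act_measurable.
by move=> mg A mA _; exact: act_preserving.
Qed.

Lemma koopman_Lfun g (f : L2) : f \o a g^-1%g \in Lfun mu 2%:E.
Proof.
have mf2 : measurable_fun [set: X] (fun x => ((f x) ^+ 2)%:E).
  by apply/measurable_EFinP; apply: measurable_funX; exact: measurable_funPT.
apply: Lfun2_of_sqr.
  by apply: measurableT_comp; [exact: measurable_funPT|exact: act_measurable].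
have := @ge0_integral_pushforward _ _ _ _ R (a g^-1%g) (act_measurable a g^-1%g) mu
  [set: X] (fun x => ((f x) ^+ 2)%:E) measurableT mf2 _.
rewrite pushforward_act preimage_setT /= => <-.
  by rewrite integral_sqrE ltry.
by move=> x _; rewrite lee_fin sqr_ge0.
Qed.

Let koopman g (f : L2) : L2 := Lfun_Sub (lee1n 2) (koopman_Lfun g f).

Definition koopman_rep : orthogonalRep G (L2_space mu).
Proof.
refine (@OrthogonalRep R G (L2_space mu) koopman _ _ _ _).
- by move=> f; apply/LfuneqP => x; rewrite /koopman /= invg1 Defs.act1.
- by move=> g h f; apply/LfuneqP => x; rewrite /koopman /= invgM Defs.actM.
- by move=> g c f h; apply/LfuneqP => x.
- move=> g f h /=; rewrite /Rintegral; congr fine.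
  have mfh : measurable_fun [set: X] (fun x => (f x * h x)%:E).
    exact: measurable_int (integrable_mul f h).
  have := @integral_pushforward _ _ _ _ R (a g^-1%g) (act_measurable a g^-1%g) mu
    [set: X] (fun x => (f x * h x)%:E) mfh.
  rewrite preimage_setT pushforward_act => -> //.
  exact: (integrable_mul (koopman g f) (koopman g h)).
Defined.

Lemma koopmanE g f x : (koopman_rep g f : L2) x = (f : L2) (a g^-1%g x).
Proof. by []. Qed.

Lemma stab_koopman_ae (f : L2) g : stab koopman_rep f g ->
  {ae mu, forall x, f (a g^-1%g x) = f x}.
Proof.
move=> /stab_null /L2_null; apply: filterS => x.
rewrite -[LHS in LHS = _ -> _]/(f (a g^-1%g x) - f x) => /eqP.
by rewrite subr_eq0 => /eqP.
Qed.

Lemma ae_forall_countable (I : Type) (P : I -> X -> Prop) :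
  countable [set: I] -> (forall i, {ae mu, forall x, P i x}) ->
  {ae mu, forall x, forall i, P i x}.
Proof.
move=> /countable_injP[r r_inj] aeP.
have : {ae mu, forall x, forall n i, r i = n -> P i x}.
  apply: ae_foralln => n.
  have [[i rin]|no] := pselect (exists i, r i = n).
    apply: filterS (aeP i) => x Px j rj.
    by have <- : i = j by apply: r_inj; rewrite ?inE // rin.
  by apply: nearW => x j rj; exfalso; apply: no; exists j.
by apply: filterS => x Px i; exact: (Px (r i) i).
Qed.

Lemma ae_const_of_le (f : L2) (c : R) : \int[mu]_x f x = c ->
  {ae mu, forall x, c <= f x} -> {ae mu, forall x, f x = c}.
Proof.
move=> fc cf.
have int_fc : mu.-integrable [set: X] (EFin \o (fun x => f x - c)).
  exact: (L2_integrable (f - Lfun_Sub (lee1n 2) (cst_Lfun2 mu c))).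
have mfc := measurable_int mu int_fc.
have : ae_eq mu [set: X] (EFin \o (fun x => f x - c)) (cst 0%E).
  apply/(ae_eq_integral_abs mu measurableT mfc).
  transitivity (\int[mu]_x ((f x - c)%:E))%E.
    apply: ae_eq_integral => //; first exact: measurableT_comp.
    by apply: filterS cf => x cfx _ /=; rewrite ger0_norm // subr_ge0.
  rewrite -[LHS]fineK; last exact: integrable_fin_num.
  congr EFin; rewrite -/(Rintegral mu setT (fun x => f x - c)).
  rewrite RintegralB //; [|exact: L2_integrable|exact: integrable_cst1].
  by rewrite fc Rintegral_cst // [X in _ * fine X]probability_setT mulr1 subrr.
by apply: filterS => x /(_ I) [] /eqP; rewrite subr_eq0 => /eqP.
Qed.

Lemma ae_const (f : L2) (c : R) : \int[mu]_x f x = c ->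
  {ae mu, forall x, c <= f x} \/ {ae mu, forall x, f x <= c} ->
  {ae mu, forall x, f x = c}.
Proof.
move=> fc [|fle]; first exact: ae_const_of_le.
have := @ae_const_of_le (- f) (- c).
have -> : \int[mu]_x (- f : L2) x = - c.
  rewrite -fc -mulN1r -RintegralZl //; last exact: L2_integrable.
  by apply: eq_Rintegral => x _; rewrite mulN1r.
move=> /(_ erefl) h; apply: filterS (h _); last first.
  by apply: filterS fle => x; rewrite -[(- f : L2) x]/(- f x) lerN2.
by move=> x; rewrite -[(- f : L2) x]/(- f x) => /oppr_inj.
Qed.

Hypothesis G_countable : countable [set: G].

(** Up to a null set, the set [E] where all translates of [f] by [H] exceed the mean
    of [f] is the set where [f] exceeds its mean, and [E] is strictly invariant. By
    ergodicity [f] lies almost everywhere on one side of its mean, hence equals it. *)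
Lemma ergodic_fixed_const (H : set G) (f : L2) :
  is_subgroup H -> ergodic_on a H -> fixed koopman_rep H f ->
  {ae mu, forall x, f x = \int[mu]_y f y}.
Proof.
move=> [H1 HM HV] ergH fH; set c := \int[mu]_y f y.
apply: ae_const => //.
have inv : {ae mu, forall x, forall h, H h -> f (a h x) = f x}.
  apply: ae_forall_countable => // h.
  have [Hh|nH] := pselect (H h); last by apply: nearW => x /nH.
  have := stab_koopman_ae (fH _ (HV _ Hh)); apply: filterS => x.
  by rewrite invgK.
pose E := [set x | forall h, H h -> c < f (a h x)].
have mE : measurable E.
  pose N h := [set x | H h /\ f (a h x) <= c].
  have -> : E = ~` \bigcup_h N h.
    apply/seteqP; split=> x.
      by move=> Ex [h _ [Hh]]; rewrite leNgt Ex.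
    move=> nx h Hh; rewrite ltNge; apply/negP => le.
    by apply: nx; exists h.
  apply: measurableC; apply: countable_bigcupT_measurable => // h.
  have [Hh|nH] := pselect (H h); last first.
    by rewrite (_ : N h = set0) // -subset0 => x [].
  have -> : N h = a h @^-1` (f @^-1` `]-oo, c]).
    by apply/seteqP; split=> x /=; rewrite in_itv /=; [case|split].
  apply: measurable_act_preimage; rewrite -[_ @^-1` _]setTI.
  exact: measurable_funPT.
have EH h : H h -> a h @` E = E.
  move=> Hh; rewrite act_image; apply/seteqP; split=> x /= Ex k Hk.
    have := Ex (k * h)%g (HM _ _ Hk Hh).
    by rewrite Defs.actM actK.
  by have := Ex (k * h^-1)%g (HM _ _ Hk (HV _ Hh)); rewrite Defs.actM.
have [E0|E1] := ergH E mE EH; [right|left].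
  have nE : {ae mu, forall x, ~ E x}.
    exists E; split=> // x /=; exact: contrapT.
  apply: filterS2 inv nE => x fx nEx; rewrite leNgt; apply/negP => cfx.
  by apply: nEx => h Hh; rewrite fx.
have aeE : {ae mu, forall x, E x}.
  exists (~` E); split=> //; first exact: measurableC.
  by rewrite probability_setC // E1 subee.
by apply: filterS aeE => x /(_ 1%g H1); rewrite Defs.act1 => /ltW.
Qed.

(** The functions fixed by a finite-index subgroup are constant, and a centered
    function is orthogonal to the constants. *)
Lemma ergodic_centered (B : set X) (mB : measurable B) :
  totally_ergodic_action a -> ergodic_vector koopman_rep (centered_indic mu mB).
Proof.
move=> te H fH f fixf.
have fc := ergodic_fixed_const fH.1 (te H fH) fixf.
set c := \int[mu]_y f y in fc.
rewrite /= /L2_ip.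
transitivity (\int[mu]_x (c * centered_indic mu mB x)).
  rewrite /Rintegral; congr fine; apply: ae_eq_integral => //.
  - exact: measurable_int (integrable_mul _ _).
  - exact: measurable_int (L2_integrable (c *: centered_indic mu mB)).
  - by apply: filterS fc => x fx _ /=; rewrite fx mulrC.
by rewrite RintegralZl ?Rintegral_centered ?mulr0 //; exact: L2_integrable.
Qed.

(** With [b] and [s] the measures of [B] and of the union [D] of its translates,
    smallness of the centered indicator of [B] tested on that of [D] reads
    [(b * (1 - s)) ^+ 2 <= e * (s * (1 - s))]. *)
Lemma directionally_expansive_of_escape :
  (forall v, ergodic_vector koopman_rep v -> forall e, 0 < e ->
    exists g, small_along koopman_rep g v e) ->
  totally_ergodic_action a -> directionally_expansive a.
Proof.
move=> esc te B mB B0 eps eps0.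
pose b := fine (mu B).
have muB : mu B = b%:E by rewrite /b mu_fine.
have b0 : 0 < b by rewrite -lte_fin -muB.
have [g gs] := esc _ (ergodic_centered mB te) (eps * b ^+ 2 / 2)
  (divr_gt0 (mulr_gt0 eps0 (exprn_gt0 2 b0)) (ltr0n _ 2)).
exists (gen [set g]); first by exists g.
set C := gen [set g]; pose D := translates a C B.
have [C1 CM CV] := gen_subgroup [set g].
have Cg : C g by exact: sub_gen.
have mD : measurable D.
  have -> : D = \bigcup_c [set x | C c /\ B (a c^-1%g x)].
    apply/seteqP; split=> x [c]; rewrite ?act_image.
      by move=> Cc Bx; exists c.
    by move=> _ [Cc Bx]; exists c => //; rewrite act_image.
  apply: countable_bigcupT_measurable => // c.
  have [Cc|nC] := pselect (C c); last first.
    by rewrite [X in measurable X](_ : _ = set0) // -subset0 => x [].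
  have -> : [set x | C c /\ B (a c^-1%g x)] = a c^-1%g @^-1` B.
    by apply/seteqP; split=> x /=; [case|split].
  exact: measurable_act_preimage.
have BD : B `<=` D by move=> x Bx; exists 1%g => //; exists x => //; rewrite Defs.act1.
have Dg x : D (a g^-1%g x) <-> D x.
  split=> -[c Cc]; rewrite act_image /= => Bx.
    exists (g * c)%g; first exact: CM.
    by rewrite act_image /= invgM Defs.actM.
  exists (g^-1 * c)%g; first by apply: CM => //; exact: CV.
  by rewrite act_image /= invgM invgK Defs.actM actK.
have stabD : stab koopman_rep (centered_indic mu mD) g.
  move=> y; rewrite -[in LHS](_ : koopman_rep g (centered_indic mu mD) =
                                   centered_indic mu mD).
    exact: orep_ip.
  apply/LfuneqP => x; rewrite koopmanE.
  rewrite -[LHS]/(\1_D (a g^-1%g x) - fine (mu D)) -[RHS]/(\1_D x - fine (mu D)).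
  congr (_ - _); rewrite !indicE; congr (_%:R : R); congr nat_of_bool.
  by apply/idP/idP => /set_mem/Dg/mem_set.
pose s := fine (mu D).
have muD : mu D = s%:E by rewrite /s mu_fine.
have := gs _ stabD.
rewrite /= (ip_centered mu mB mD BD) (ip_centered mu mD mD (@subset_refl _ D)).
rewrite -/b -/s => small.
have s0 : 0 <= s by rewrite fine_ge0.
have s1 : s <= 1 by rewrite -lee_fin -muD probability_le1.
rewrite -/D muD lte_fin ltNge; apply/negP => s_small.
have t0 : 0 < 1 - s by lra.
have small' : b ^+ 2 * (1 - s) <= eps * b ^+ 2 / 2 * s.
  rewrite -(ler_pM2r t0); apply: le_trans (le_trans _ small) _.
    by rewrite le_eqVlt; apply/orP; left; apply/eqP; ring.
  by rewrite le_eqVlt; apply/orP; left; apply/eqP; ring.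
have b2 : 0 < b ^+ 2 by rewrite exprn_gt0.
have h1 : b ^+ 2 * eps <= b ^+ 2 * (1 - s) by rewrite ler_pM2l //; lra.
have h2 : eps * b ^+ 2 / 2 * s <= eps * b ^+ 2 / 2.
  by rewrite ler_piMr // divr_ge0 // mulr_ge0 ?ltW.
have h3 : 0 < eps * b ^+ 2 by rewrite mulr_gt0.
by clear - small' h1 h2 h3; lra.
Qed.

End Koopman.

Theorem theorem1p4 (R : realType) (G : groupType)
    (G_infinite : infinite_set [set: G])
    (G_fg : finitely_generated G)
    (G_nilpotent : nilpotent_group G) :
  cyclic_escape_property R G /\
  (forall (d : measure_display) (X : measurableType d) (mu : probability X R)
     (a : pmpAction G mu),
     totally_ergodic_action a -> directionally_expansive a).
Proof.
split=> [|d X mu a]; first exact: nilpotent_cyclic_escape.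
apply: directionally_expansive_of_escape.
  exact: finitely_generated_countable.
move=> v v_erg e e0.
by have [g [gs _]] := nilpotent_escape G_infinite G_fg G_nilpotent v_erg e0; exists g.
Qed.
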